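(* Let $S$ be an $n\times n$ Hermitian matrix with simple spectrum $\lambda_1<\dots<\lambda_n$, let $\mathcal{Q}=[q_1,\dots,q_n]$ be a normalized (orthonormal) eigenbasis of $S$, and let $\mathcal{O}_Q$ be the associated positive orthant. Let $r>0$ and $c\in\mathbb{R}$. The following maps are homeomorphisms, and they restrict to diffeomorphisms between the interiors of their domains and of their images: \[ F:\mathcal{O}_Q\to\mathcal{P}_F,\qquad F(v)=\sigma_o(S+v\otimes v), \] \[ G:\mathcal{O}_Q\times\mathbb{R}\to\mathcal{P}_G,\qquad G(v,c)=\sigma_o(T(v,c)), \] and their restrictions \[ F^r:\mathcal{O}_Q\cap\mathcal{S}(r)\to \mathcal{P}_F^r=\mathcal{P}_F\cap\Big\{\mu\in\mathbb{R}^n:\ \sum_j\mu_j=r^2+\sum_j\lambda_j\Big\}, \] \[ G^c:\mathcal{O}_Q\times\{c\}\to\mathcal{P}_G^c=\mathcal{P}_G\cap\Big\{\mu\in\mathbb{R}^{n+1}:\ \sum_j\mu_j=\sum_k\lambda_k+c\Big\}, \] \[ G^{r,c}:(\mathcal{O}_Q\cap\mathcal{S}(r))\times\{c\}\to\mathcal{P}_G^c\cap\Big\{\mu\in\mathbb{R}^{n+1}:\ \sum_j\mu_j^2=\sum_k\lambda_k^2+2r^2+c^2\Big\}. \]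
   Context: $\mathbb{C}^n$ carries the Euclidean Hermitian inner product $\langle\cdot,\cdot\rangle$, anti-linear in the second coordinate. For $v\in\mathbb{C}^n$ (a column vector), $v\otimes v=vv^\ast$ is the rank one map $u\mapsto\langle u,v\rangle v$. For $v\in\mathbb{C}^n$, $c\in\mathbb{R}$, the bordered matrix is the $(n+1)\times(n+1)$ Hermitian matrix \[ T(v,c)=\begin{pmatrix} S & v\\ v^\ast & c\end{pmatrix}. \] For a Hermitian matrix $A$, $\sigma_o(A)$ is the real vector whose entries are the eigenvalues of $A$, with multiplicity, in nondecreasing order. If $Q$ is the unitary matrix with columns $q_1,\dots,q_n$, the positive orthant associated with $\mathcal{Q}$ is $\mathcal{O}_Q=\{Qp: p\in\mathbb{R}^n,\ p_j\ge0 \text{ for all } j\}\subset\mathbb{C}^n$. It is identified with the closed positive orthant of $\mathbb{R}^n$ via $p\mapsto Qp$; its interior is $\{Qp: p_j>0\text{ for all }j\}$. For $r>0$, $\mathcal{S}(r)=\{v\in\mathbb{C}^n:\|v\|=r\}$. The polytopes are \[ \mathcal{P}_F=[\lambda_1,\lambda_2]\times[\lambda_2,\lambda_3]\times\dots\times[\lambda_{n-1},\lambda_n]\times[\lambda_n,\infty)\subset\mathbb{R}^n, \] \[ \mathcal{P}_G=(-\infty,\lambda_1]\times[\lambda_1,\lambda_2]\times\dots\times[\lambda_{n-1},\lambda_n]\times[\lambda_n,\infty)\subset\mathbb{R}^{n+1}. \] For the restricted maps, the interior of the domain is its intersection with the interior of $\mathcal{O}_Q$ (respectively of $\mathcal{O}_Q\times\mathbb{R}$),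 and the interior of the image is its intersection with the topological interior of $\mathcal{P}_F$ in $\mathbb{R}^n$ (respectively of $\mathcal{P}_G$ in $\mathbb{R}^{n+1}$), these being regarded as submanifolds. *)

(* Defs.v *)
From HB Require Import structures.
From mathcomp Require Import all_boot all_order all_algebra.
From mathcomp Require Import all_classical all_reals all_analysis.
From mathcomp Require Import complex.

Set Implicit Arguments.
Unset Strict Implicit.
Unset Printing Implicit Defensive.

Import Order.TTheory GRing.Theory Num.Theory.
Import numFieldNormedType.Exports.

Local Open Scope classical_set_scope.
Local Open Scope ring_scope.
Local Open Scope complex_scope.
Local Open Scope sesquilinear_scope.

(* MathComp-Analysis topologizes every abstract numFieldType, but these
   instances are not inferred for the concrete type R[i]; they are copied here
   from R[i]^o, so that 'cV[R[i]]_n carries the usual topology of C^n. *)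
HB.instance Definition _ (R : realType) :=
  PseudoMetricNormedZmod.copy R[i] (R[i])^o.

Section Maps.

Definition homeomorphism_on (X Y : topologicalType) (A : set X) (B : set Y)
    (f : X -> Y) : Prop :=
  exists g : Y -> X,
    [/\ (forall x, A x -> B (f x)) /\ (forall y, B y -> A (g y)),
        forall x, A x -> g (f x) = x,
        forall y, B y -> f (g y) = y,
        {within A, continuous f}
      & {within B, continuous g}].

(* Class C^k on U; only meaningful for U open.  A map is C^(k+1) iff it is
   differentiable with all its directional derivatives of class C^k. *)
Fixpoint Ck (R : realType) (E W : normedModType R) (k : nat) (U : set E)
    (f : E -> W) : Prop :=
  match k with
  | 0 => forall x, U x -> {for x, continuous f}
  | k'.+1 => (forall x, U x -> differentiable f x) /\
             (forall v : E, Ck k' U (fun x => 'D_v f x))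
  end.

(* Smoothness on a subset A that need not be open: f extends, near every point
   of A, to a C^oo map on an open set of the ambient space.  When A is a
   submanifold this is smoothness for its submanifold structure. *)
Definition smooth_on (R : realType) (E W : normedModType R) (A : set E)
    (f : E -> W) : Prop :=
  forall x, A x -> exists (U : set E) (g : E -> W),
    [/\ open U, U x, forall k, Ck k U g & forall y, U y -> A y -> g y = f y].

Definition diffeomorphism_on (R : realType) (E W : normedModType R)
    (A : set E) (B : set W) (f : E -> W) : Prop :=
  exists g : W -> E,
    [/\ (forall x, A x -> B (f x)) /\ (forall y, B y -> A (g y)),
        forall x, A x -> g (f x) = x,
        forall y, B y -> f (g y) = y,
        smooth_on A f
      & smooth_on B g].

End Maps.

Section Eigenvalues.
Variable R : realType.

Definition eigenvalue_seq n (A : 'M[R[i]]_n) : seq R[i] :=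
  sval (closed_field_poly_normal (char_poly A)).

(* Meant for Hermitian A, whose eigenvalues are real. *)
Definition sigma_o n (A : 'M[R[i]]_n) : 'cV[R]_n :=
  \col_j (sort <=%R [seq complex.Re z | z <- eigenvalue_seq A])`_j.

Definition orthonormal_eigenbasis n (S Q : 'M[R[i]]_n) : Prop :=
  Q \is unitarymx /\
  forall j, exists a : R[i], S *m col j Q = a *: col j Q.

End Eigenvalues.

Section Spaces.
Variables (R : realType) (n : nat).

Definition cdot (u v : 'cV[R[i]]_n) : R[i] := (v^t* *m u) 0 0.

Definition cnorm (v : 'cV[R[i]]_n) : R[i] := sqrtC (cdot v v).

Definition csphere (r : R) : set 'cV[R[i]]_n := [set v | cnorm v = r%:C].

Definition tensor_sq (v : 'cV[R[i]]_n) : 'M[R[i]]_n := v *m v^t*.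

Definition bordered (S : 'M[R[i]]_n) (v : 'cV[R[i]]_n) (c : R)
  : 'M[R[i]]_(n + 1) := block_mx S v (v^t*) c%:C%:M.

(* The identification p |-> Qp of R^n with a real subspace of C^n. *)
Definition chart (Q : 'M[R[i]]_n) (p : 'cV[R]_n) : 'cV[R[i]]_n :=
  Q *m map_mx (real_complex R) p.

Definition chart1 (Q : 'M[R[i]]_n) (pc : 'cV[R]_n * R) : 'cV[R[i]]_n * R :=
  (chart Q pc.1, pc.2).

Definition orthant (Q : 'M[R[i]]_n) : set 'cV[R[i]]_n :=
  [set chart Q p | p in [set p : 'cV[R]_n | forall j, 0 <= p j 0]].

Definition orthant_interior (Q : 'M[R[i]]_n) : set 'cV[R[i]]_n :=
  [set chart Q p | p in [set p : 'cV[R]_n | forall j, 0 < p j 0]].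

(* With 0-based indices: mu_k lies in [lam_k, lam_(k+1)], and the last
   interval is unbounded above. *)
Definition polyF (lam : 'cV[R]_n) : set 'cV[R]_n :=
  [set mu | forall k : 'I_n,
     lam k 0 <= mu k 0 /\
     (forall j : 'I_n, j = k.+1 :> nat -> mu k 0 <= lam j 0)].

(* With 0-based indices: mu_k lies in [lam_(k-1), lam_k], the first interval
   being unbounded below and the last one unbounded above. *)
Definition polyG (lam : 'cV[R]_n) : set 'cV[R]_(n + 1) :=
  [set mu | forall k : 'I_(n + 1),
     (forall j : 'I_n, j.+1 = k :> nat -> lam j 0 <= mu k 0) /\
     (forall j : 'I_n, j = k :> nat -> mu k 0 <= lam j 0)].

Definition polyFr (lam : 'cV[R]_n) (r : R) : set 'cV[R]_n :=
  polyF lam `&`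
  [set mu | \sum_j mu j 0 = r ^+ 2 + \sum_j lam j 0].

Definition polyGc (lam : 'cV[R]_n) (c : R) : set 'cV[R]_(n + 1) :=
  polyG lam `&`
  [set mu | \sum_j mu j 0 = \sum_k lam k 0 + c].

Definition polyGrc (lam : 'cV[R]_n) (r c : R) : set 'cV[R]_(n + 1) :=
  polyGc lam c `&`
  [set mu | \sum_j mu j 0 ^+ 2 = \sum_k lam k 0 ^+ 2 + 2 * r ^+ 2 + c ^+ 2].

Definition mapF (S : 'M[R[i]]_n) (v : 'cV[R[i]]_n) : 'cV[R]_n :=
  sigma_o (S + tensor_sq v).

Definition mapG (S : 'M[R[i]]_n) (vc : 'cV[R[i]]_n * R) : 'cV[R]_(n + 1) :=
  sigma_o (bordered S vc.1 vc.2).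

(* f restricts to a homeomorphism A -> B and to a diffeomorphism between the
   interiors of A and B; smoothness on the domain side is read in the real
   coordinates p of v = Qp, through the charts above. *)
Definition homeo_diffeoF (Q : 'M[R[i]]_n) (lam : 'cV[R]_n)
    (A : set 'cV[R[i]]_n) (B : set 'cV[R]_n)
    (f : 'cV[R[i]]_n -> 'cV[R]_n) : Prop :=
  homeomorphism_on A B f /\
  diffeomorphism_on (chart Q @^-1` (A `&` orthant_interior Q))
    (B `&` interior (polyF lam)) (f \o chart Q).

Definition homeo_diffeoG (Q : 'M[R[i]]_n) (lam : 'cV[R]_n)
    (A : set ('cV[R[i]]_n * R)) (B : set 'cV[R]_(n + 1))
    (f : 'cV[R[i]]_n * R -> 'cV[R]_(n + 1)) : Prop :=
  homeomorphism_on A B f /\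
  diffeomorphism_on (chart1 Q @^-1` (A `&` (orthant_interior Q `*` setT)))
    (B `&` interior (polyG lam)) (f \o chart1 Q).

End Spaces.

(* Main.v *)
Require Import Defs.
From HB Require Import structures.
From mathcomp Require Import all_boot all_order all_algebra.
From mathcomp Require Import all_classical all_reals all_analysis.
From mathcomp Require Import perm complex ring lra zify.
Set Implicit Arguments.
Unset Strict Implicit.
Unset Printing Implicit Defensive.
Import Order.TTheory GRing.Theory Num.Theory.
Import numFieldNormedType.Exports.
Local Open Scope classical_set_scope.
Local Open Scope ring_scope.
Local Open Scope complex_scope.

(** In the orthonormal eigenbasis, v = Qp, and S becomes a diagonal matrix with
    entries d_j, a permutation of lam.  A determinant computation ([det_arrow])
    gives the characteristic polynomials of S + v (x) v and of T(v, c):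
      [secular]   L * prod_j (X - d_j) - sum_j p_j^2 prod_(i <> j) (X - d_i)
    with L = 1 for F and L = X - c for G.  Evaluating at d_j isolates p_j^2, so
    the inverse map is explicit: p_j is the square root of
      [weight]    - prod_k (d_j - mu_k) / prod_(i <> j) (d_j - d_i),
    and c is the difference of the sums of mu and lam.  Conversely, a polynomial
    of degree less than n is determined by its values at the n nodes, so the
    spectrum of the matrix built from these p_j (and c) is mu
    ([secular_of_weight]).

    Both polytopes are instances of one [interlacing] condition with a shift
    s = 0 (for F) or s = 1 (for G): with indices from 0, the first j + s of the
    mu_k lie at or below lam_j and the others at or above it.  Under interlacing
    the weights are nonnegative ([weight_ge0]), so that the formula for p_j
    makes sense.  In the other direction, when all p_j are positive
    the signs of the characteristic polynomial at the lam_j fix the parity of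
    the number of mu_k above lam_j, and this forces interlacing
    ([interlacing_of_weight_gt0]).  The boundary of the orthant and the
    continuity of the map itself are obtained at once from compactness: the
    inverse is continuous, and points of a bounded part of the orthant have
    spectra in a compact part of the polytope
    ([proper_inverse_continuous]).  No perturbation theory of eigenvalues is
    involved.

    Smoothness of the inverse in the interior is read off the formula, since the
    weights are positive there.  Smoothness of the direct map is that of the
    simple roots of a polynomial with smooth coefficients
    ([Ck_simple_roots]).  These arguments are carried out once for both maps, in
    [spectral_map_homeo_diffeo].

    The three remaining maps are restrictions: by the traces of a Hermitian
    matrix and of its square, the equations that define P_F^r, P_G^c and the
    last image hold at the spectrum exactly when |p| = r, when the corner entry
    is c, or both. *)

(** * Maps of class C^k *)

Section Differentiability.
Variables (R : realType) (E W : normedModType R).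

Lemma differentiable_littleo (f : E -> W) (df : {linear E -> W}) x :
  continuous df ->
  (forall e, 0 < e -> \forall h \near (0 : E),
     `|f (h + x) - (f x + df h)| <= e * `|h|) ->
  differentiable f x /\ 'd f x = df :> (E -> W).
Proof.
move=> cdf fo.
have fE : f \o shift x = cst (f x) + df +o_ (0 : E) id.
  apply/eqaddoP => e e0.
  by apply: filterS (fo e e0) => h /=.
have dE := diff_unique cdf fE.
by split => //; apply/diff_locallyP; rewrite dE.
Qed.

Lemma differentiable_near_eq (f g : E -> W) x :
  {near x, f =1 g} -> differentiable f x -> differentiable g x.
Proof.
move=> fg df; have [cdf fo] := (diff_locallyP x f).1 df.
have fgx : f x = g x := nbhs_singleton fg.
apply: (differentiable_littleo cdf _).1 => e e0.
move/eqaddoP: fo => /(_ e e0) fo.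
rewrite (near_shift 0 x) in fg.
near=> h.
have <- : f (h + x) = g (h + x).
  have : (f \o shift (x - 0)) h = (g \o shift (x - 0)) h by near: h.
  by rewrite /= subr0.
by rewrite -fgx; near: h.
Unshelve. all: by end_near. Qed.

End Differentiability.

(** Where a vanishes, mere continuity of b suffices: with da the differential,
    a b - b(x) da = (a - da) b + da (b - b(x)), and both terms are o(h). *)
Lemma differentiableM_zero (R : realType) (E : normedModType R) (a b : E -> R) x :
  differentiable a x -> a x = 0 -> {for x, continuous b} ->
  differentiable (fun y => a y * b y) x /\
  forall v, 'D_v (fun y => a y * b y) x = 'D_v a x * b x.
Proof.
move=> da ax cb; have [cda ao] := (diff_locallyP x a).1 da.
suff [dab dabE] : differentiable (fun y => a y * b y) x /\
    'd (fun y => a y * b y) x = (b x \*: 'd a x) :> (E -> R).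
  by split=> // v; rewrite !deriveE// dabE /= mulrC.
apply: differentiable_littleo.
  move=> y; apply: cvgM; [exact: cvg_cst|exact: cda].
move=> e e0.
suff h0 : \forall h \near (0 : E),
    `|a (h + x) * b (h + x) - b x * 'd a x h| <= e * `|h|.
  by apply: filterS h0 => h; rewrite ax mul0r add0r.
have [k k0 dak] := linear_lipschitz cda.
have M0 : 0 < `|b x| + 1 by rewrite ltr_wpDl.
have e1 : 0 < e / 2 / (`|b x| + 1) by rewrite !divr_gt0.
have e2 : 0 < e / 2 / k by rewrite !divr_gt0.
move/eqaddoP: ao => /(_ _ e1) ao.
have cb' : b (h + x) @[h --> (0:E)] --> b x.
  have -> : nbhs (b x) = nbhs (b (0 + x)) by rewrite add0r.
  apply: continuous_comp; last by rewrite add0r.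
  by apply: cvgD; [exact: cvg_id|exact: cvg_cst].
near=> h.
have -> : a (h + x) * b (h + x) - b x * 'd a x h =
  (a (h + x) - 'd a x h) * b (h + x) + 'd a x h * (b (h + x) - b x).
  by ring.
have -> : e * `|h| = e / 2 * `|h| + e / 2 * `|h| by rewrite -mulrDl -splitr.
rewrite (le_trans (ler_normD _ _))// lerD// normrM.
- have h1 : `|a (h + x) - 'd a x h| <= e / 2 / (`|b x| + 1) * `|h|.
    near: h; apply: filterS ao => h /=; rewrite ax.
    by congr (`|_ - _| <= _); exact: add0r.
  have h2 : `|b (h + x)| <= `|b x| + 1.
    have : `|b x - b (h + x)| <= 1 by near: h; move/cvgrPdist_le: cb'; apply.
    by rewrite distrC => /(le_trans (lerB_dist _ _)); rewrite lerBlDl.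
  rewrite (le_trans (ler_pM _ _ h1 h2))// mulrAC divfK// gt_eqF//.
- have h2 : `|b x - b (h + x)| <= e / 2 / k
    by near: h; move/cvgrPdist_le: cb'; apply.
  rewrite distrC in h2.
  rewrite (le_trans (ler_pM _ _ (dak h) h2))//.
  by rewrite mulrAC [k * _]mulrC divfK// gt_eqF.
Unshelve. all: by end_near. Qed.

Section CkCalculus.
Variables (R : realType) (E : normedModType R) (U : set E).
Hypothesis openU : open U.
Implicit Types (W : normedModType R) (f g : E -> R) (k : nat).

Lemma near_open_eq W (F G : E -> W) x :
  U x -> (forall y, U y -> F y = G y) -> {near x, F =1 G}.
Proof.
move=> Ux FG.
by apply: filterS (open_nbhs_nbhs (conj openU Ux)) => z Uz; exact/FG.
Qed.

Lemma Ck_eq W k (F G : E -> W) :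
  (forall x, U x -> F x = G x) -> Ck k U F -> Ck k U G.
Proof.
elim: k F G => [|k IH] F G FG /= CF.
  move=> x Ux; apply: cvg_trans (_ : F @ x --> G x).
    by apply: near_eq_cvg; apply: near_open_eq => // y Uy.
  by rewrite -FG//; exact: CF.
case: CF => dF DF; split.
  by move=> x Ux; apply: differentiable_near_eq (dF x Ux); exact: near_open_eq.
move=> v; apply: IH (DF v) => x Ux; apply: near_eq_derive.
exact: near_open_eq.
Qed.

Lemma CkW W k (F : E -> W) : Ck k.+1 U F -> Ck k U F.
Proof.
elim: k F => [|k IH] F [dF DF].
  by move=> x Ux; apply: differentiable_continuous; exact: dF.
by split=> // v; exact: IH (DF v).
Qed.

Lemma Ck_subset W k (V : set E) (F : E -> W) :
  V `<=` U -> Ck k U F -> Ck k V F.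
Proof.
move=> VU; elim: k F => [|k IH] F /=; first by move=> cF x /VU; exact: cF.
by move=> [dF DF]; split=> [x /VU|v]; [exact: dF|exact: IH (DF v)].
Qed.

Lemma Ck_cst W k (w : W) : Ck k U (fun=> w).
Proof.
elim: k w => [|k IH] w; first by move=> x _; exact: cst_continuous.
split=> [x _|v]; first exact: differentiable_cst.
by apply: Ck_eq (IH 0) => x _; rewrite derive_cst.
Qed.

Lemma Ck_linear W k (L : {linear E -> W}) : continuous L -> Ck k U L.
Proof.
move=> cL; case: k => [|k]; first by move=> x _; exact: cL.
split=> [x _|v]; first exact: linear_differentiable.
apply: Ck_eq (Ck_cst k (L v)) => x _.
by rewrite deriveE ?diff_lin//; exact: linear_differentiable.
Qed.

Lemma CkD W k (F G : E -> W) :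
  Ck k U F -> Ck k U G -> Ck k U (fun x => F x + G x).
Proof.
elim: k F G => [|k IH] F G.
  by move=> cF cG x Ux; apply: cvgD; [exact: cF|exact: cG].
move=> [dF DF] [dG DG]; split=> [x Ux|v].
  by apply: differentiableD; [exact: dF|exact: dG].
apply: Ck_eq (IH _ _ (DF v) (DG v)) => x Ux.
rewrite -[RHS]/('D_v (F + G) x).
by rewrite deriveD//; apply: diff_derivable; [exact: dF|exact: dG].
Qed.

Lemma CkM k f g : Ck k U f -> Ck k U g -> Ck k U (fun x => f x * g x).
Proof.
elim: k f g => [|k IH] f g.
  by move=> cF cG x Ux; apply: cvgM; [exact: cF|exact: cG].
move=> Cf Cg; have [df Df] := Cf; have [dg Dg] := Cg; split=> [x Ux|v].
  by apply: differentiableM; [exact: df|exact: dg].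
have := CkD (IH _ _ (CkW Cf) (Dg v)) (IH _ _ (CkW Cg) (Df v)).
apply: Ck_eq => x Ux.
rewrite -[RHS]/('D_v (f * g) x).
by rewrite deriveM//; apply: diff_derivable; [exact: df|exact: dg].
Qed.

Lemma Ck_scalel W k f (w : W) : Ck k U f -> Ck k U (fun x => f x *: w).
Proof.
elim: k f => [|k IH] f.
  by move=> cF x Ux; apply: cvgZr_tmp; exact: cF.
move=> [df Df]; split=> [x Ux|v].
  exact: (differentiableZl w (df x Ux)).
apply: Ck_eq (IH _ (Df v)) => x Ux.
rewrite (deriveE _ (differentiableZl w (df x Ux))).
by rewrite (diffZl w (df x Ux)) /= deriveE//; exact: df.
Qed.

Lemma CkN k f : Ck k U f -> Ck k U (fun x => - f x).
Proof.
move=> Cf; apply: Ck_eq (CkM (Ck_cst k (-1 : R)) Cf) => x _.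
by rewrite mulN1r.
Qed.

Lemma CkB k f g : Ck k U f -> Ck k U g -> Ck k U (fun x => f x - g x).
Proof. by move=> Cf Cg; exact: CkD (CkN Cg). Qed.

Lemma Ck_sum W k (I : Type) (s : seq I) (P : pred I) (F : I -> E -> W) :
  (forall i, P i -> Ck k U (F i)) -> Ck k U (fun x => \sum_(i <- s | P i) F i x).
Proof.
move=> CF; elim: s => [|i s IH].
  by apply: Ck_eq (Ck_cst k (0 : W)) => x _; rewrite big_nil.
have [Pi|nPi] := boolP (P i).
  by apply: Ck_eq (CkD (CF i Pi) IH) => x _; rewrite big_cons Pi.
by apply: Ck_eq IH => x _; rewrite big_cons (negPf nPi).
Qed.

Lemma Ck_prod k (I : Type) (s : seq I) (P : pred I) (F : I -> E -> R) :
  (forall i, P i -> Ck k U (F i)) ->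
  Ck k U (fun x => \prod_(i <- s | P i) F i x).
Proof.
move=> CF; elim: s => [|i s IH].
  by apply: Ck_eq (Ck_cst k (1 : R)) => x _; rewrite big_nil.
have [Pi|nPi] := boolP (P i).
  by apply: Ck_eq (CkM (CF i Pi) IH) => x _; rewrite big_cons Pi.
by apply: Ck_eq IH => x _; rewrite big_cons (negPf nPi).
Qed.

Lemma CkX k f n : Ck k U f -> Ck k U (fun x => f x ^+ n).
Proof.
move=> Cf; elim: n => [|n IH].
  by apply: Ck_eq (Ck_cst k (1 : R)) => x _; rewrite expr0.
by apply: Ck_eq (CkM Cf IH) => x _; rewrite exprS.
Qed.

Lemma CkV k f : (forall x, U x -> f x != 0) -> Ck k U f ->
  Ck k U (fun x => (f x)^-1).
Proof.
move=> f0; elim: k => [|k IH].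
  by move=> cF x Ux; apply: cvgV; [exact: f0|exact: cF].
move=> Cf; have [df Df] := Cf; split=> [x Ux|v].
  by apply: differentiableV; [exact: df|exact: f0].
have := CkN (CkM (CkX 2 (IH (CkW Cf))) (Df v)).
apply: Ck_eq => x Ux.
rewrite deriveV//; [|exact: f0|by apply: diff_derivable; exact: df].
by rewrite scaleNr -exprVn.
Qed.

Lemma Ck_sqrt k f : (forall x, U x -> 0 < f x) -> Ck k U f ->
  Ck k U (fun x => Num.sqrt (f x)).
Proof.
move=> f0; elim: k => [|k IH].
  move=> cF x Ux; apply: continuous_comp; first exact: cF.
  exact: sqrt_continuous.
move=> Cf; have [df Df] := Cf.
have dsqrt x : U x -> differentiable (Num.sqrt : R -> R) (f x).
  by move=> Ux; apply/derivable1_diffP; have [] := is_derive1_sqrt (f0 x Ux).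
split=> [x Ux|v].
  by apply: differentiable_comp; [exact: df|exact: dsqrt].
have s0 x : U x -> 2 * Num.sqrt (f x) != 0.
  by move=> Ux; rewrite mulf_neq0// gt_eqF// sqrtr_gt0 f0.
have ds x : U x -> differentiable (fun y => Num.sqrt (f y)) x.
  by move=> Ux; apply: differentiable_comp; [exact: df|exact: dsqrt].
have := CkM (Df v) (CkV s0 (CkM (Ck_cst k (2 : R)) (IH (CkW Cf)))).
apply: Ck_eq => x Ux.
(* the product rule for sqrt f * sqrt f = f gives the derivative of sqrt f *)
have -> : 'D_v f x =
    'D_v ((fun y => Num.sqrt (f y)) * (fun y => Num.sqrt (f y))) x.
  apply: near_eq_derive; apply: near_open_eq => // y Uy.
  by rewrite -[RHS]/(Num.sqrt (f y) * Num.sqrt (f y)) -expr2 sqr_sqrtr// ltW// f0.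
have dv : derivable (fun y => Num.sqrt (f y)) x v by exact/diff_derivable/ds.
rewrite deriveM//= /GRing.scale/= -mulr2n -[X in X / _]mulr_natl.
by rewrite mulrA mulrAC divff ?mul1r// s0.
Qed.

Lemma Ck_pair W W' k (F : E -> W) (G : E -> W') :
  Ck k U F -> Ck k U G -> Ck k U (fun x => (F x, G x)).
Proof.
elim: k F G => [|k IH] F G.
  by move=> cF cG x Ux; apply: cvg_pair; [exact: cF|exact: cG].
move=> [dF DF] [dG DG]; split=> [x Ux|v].
  by apply: differentiable_pair; [exact: dF|exact: dG].
apply: Ck_eq (IH _ _ (DF v) (DG v)) => x Ux.
have dFG := differentiable_pair (dF x Ux) (dG x Ux).
by rewrite (deriveE _ dFG) (diff_pair (dF x Ux) (dG x Ux)) !deriveE//;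
  [exact: dG|exact: dF].
Qed.

(** A map into column vectors is the sum of its coordinates times the standard
    basis, so smoothness may be checked coordinatewise. *)
Lemma Ck_cV k m (F : E -> 'cV[R]_m) :
  (forall i, Ck k U (fun x => F x i 0)) -> Ck k U F.
Proof.
move=> CF; apply: (@Ck_eq _ _
  (fun x => \sum_i F x i 0 *: (delta_mx i 0 : 'cV[R]_m))).
  move=> x _; rewrite [RHS]matrix_sum_delta.
  by apply: eq_bigr => i _; rewrite big_ord1.
by apply: Ck_sum => i _; exact: Ck_scalel.
Qed.

End CkCalculus.

(** * Smooth dependence of simple roots *)

Section SmoothRoots.
Variables (R : realType) (E : normedModType R) (U : set E) (m : nat).
Variables (chi : E -> {poly R}) (mu : E -> 'cV[R]_m).
Hypothesis openU : open U.
Hypothesis chiE : forall x, U x -> chi x = \prod_(i < m) ('X - (mu x i 0)%:P).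
Hypothesis chi_smooth : forall l k, Ck k U (fun x => (chi x)`_l).
Hypothesis mu_cont : forall i x, U x -> {for x, continuous (fun y => mu y i 0)}.
Hypothesis mu_inj : forall x, U x -> injective (fun i => mu x i 0).

Let gap i t x := \prod_(j < m | j != i) (t - mu x j 0).

Let gap_neq0 i x : U x -> gap i (mu x i 0) x != 0.
Proof.
move=> Ux; apply/prodf_neq0 => j ji; rewrite subr_eq0; apply: contra ji.
by move/eqP/(mu_inj Ux) => ->.
Qed.

Let chi_horner t x : U x -> \sum_(l < m.+1) (chi x)`_l * t ^+ l = (chi x).[t].
Proof.
move=> Ux; rewrite -horner_coef_wide// chiE//.
by rewrite size_prod_XsubC /index_enum -enumT size_enum_ord.
Qed.

Let chi_gap i t x : U x -> (chi x).[t] = (t - mu x i 0) * gap i t x.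
Proof.
move=> Ux; rewrite chiE// horner_prod (bigD1 i)//= !hornerE; congr (_ * _).
by apply: eq_bigr => j _; rewrite !hornerE.
Qed.

Let root_diff i x : U x ->
  differentiable (fun y => mu y i 0) x /\
  forall v, 'D_v (fun y => mu y i 0) x =
    - ((\sum_(l < m.+1) 'D_v (fun y => (chi y)`_l) x * mu x i 0 ^+ l)
       * (gap i (mu x i 0) x)^-1).
Proof.
move=> Ux; set t := mu x i 0.
pose a y := \sum_(l < m.+1) (chi y)`_l * t ^+ l.
pose b y := (gap i t y)^-1.
have Ca k : Ck k U a.
  by apply: Ck_sum => // l _; apply: CkM => //; exact: Ck_cst.
have [da _] := Ca 1%N.
have ax : a x = 0 by rewrite /a chi_horner// (chi_gap i)// subrr mul0r.
have cgap : {for x, continuous (gap i t)}.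
  suff : Ck 0 U (gap i t) by apply.
  apply: Ck_prod => // j _; apply: CkB => //; first exact: Ck_cst.
  exact: mu_cont.
have cb : {for x, continuous b} by apply: cvgV cgap; exact: gap_neq0.
have muE : {near x, (fun y => t - a y * b y) =1 (fun y => mu y i 0)}.
  near=> y; have Uy : U y by near: y; exact: open_nbhs_nbhs.
  have g0 : gap i t y != 0 by near: y; apply: cvgr_neq0 cgap _; exact: gap_neq0.
  by rewrite /a /b chi_horner// (chi_gap i)// mulfK// opprB addrC subrK.
have [dab Dab] := differentiableM_zero (da x Ux) ax cb.
have dr : differentiable (cst t - (fun y => a y * b y)) x.
  by apply: differentiableB => //; exact: differentiable_cst.
split; first exact: differentiable_near_eq muE dr.
move=> v; rewrite -(near_eq_derive _ muE).
rewrite -[LHS]/('D_v (cst t - (fun y => a y * b y)) x).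
rewrite (deriveB (derivable_cst t x v) (diff_derivable dab)).
rewrite derive_cst sub0r Dab; congr (- (_ * _)).
have dcoef (l : 'I_m.+1) : differentiable (fun y => (chi y)`_l) x.
  by have [+ _] := chi_smooth l 1; apply.
have -> : a = \sum_(l < m.+1) (t ^+ l *: (fun y => (chi y)`_l)).
  apply/funext => y; rewrite fct_sumE.
  by apply: eq_bigr => l _; rewrite mulrC.
have ddc l := diff_derivable (v := v) (dcoef l).
rewrite (derive_sum (fun l => derivableZ (ddc l))).
by apply: eq_bigr => l _; rewrite (deriveZ _ (ddc l)) mulrC.
Unshelve. all: by end_near. Qed.

(** At the frozen argument t = mu_i x0, the factorization of chi x writes
    t - mu_i x as the value of chi x at t, which is smooth in x and vanishes at
    x0, divided by the gap to the other roots, which is continuous and nonzero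
    at x0.  So the root is differentiable, and its derivative is a rational
    function of the derivatives of the coefficients and of the roots
    themselves: smoothness bootstraps by induction on the order. *)
Theorem Ck_simple_roots k : Ck k U mu.
Proof.
apply: Ck_cV => //; elim: k => [|k IH] i; first exact: mu_cont.
split=> [x Ux|v]; first by have [] := root_diff i Ux.
pose F x := - ((\sum_(l < m.+1) 'D_v (fun y => (chi y)`_l) x * mu x i 0 ^+ l)
       * (\prod_(j < m | j != i) (mu x i 0 - mu x j 0))^-1).
apply: (@Ck_eq _ _ _ openU _ _ F) => [x Ux|].
  by have [_ ->] := root_diff i Ux.
apply: CkN => //; apply: CkM => //.
  apply: Ck_sum => // l _; apply: CkM => //; last exact: CkX.
  by have [_] := chi_smooth l k.+1; apply.
apply: CkV => // [x Ux|]; first exact: (gap_neq0 i Ux).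
by apply: Ck_prod => // j _; exact: CkB.
Qed.

End SmoothRoots.

(** * Homeomorphisms and diffeomorphisms *)

Lemma cvg_mx (I : Type) (F : set_system I) {FF : Filter F}
    (T : ptopologicalType) m n (f : I -> 'M[T]_(m, n)) (M : 'M[T]_(m, n)) :
  (forall i j, f x i j @[x --> F] --> M i j) -> f @ F --> M.
Proof.
move=> fM A [P PM PA].
have : \forall x \near F, forall i j, P i j (f x i j).
  apply: filter_forall => i; apply: filter_forall => j; exact: fM.
by apply: filterS => x Px; exact: PA.
Qed.

Lemma continuous_pair (X Y Z : topologicalType) (f : X -> Y) (g : X -> Z) :
  continuous f -> continuous g -> continuous (fun x => (f x, g x)).
Proof. by move=> cf cg x; apply: cvg_pair; [exact: cf|exact: cg]. Qed.

Lemma continuous_mx_coord (T : ptopologicalType) m n i j :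
  continuous (fun M : 'M[T]_(m, n) => M i j).
Proof.
move=> M A AM; exists (fun i' j' => if (i' == i) && (j' == j) then A else setT).
  by move=> i' j'; case: ifP => [/andP[/eqP-> /eqP->]//|_]; exact: filterT.
by move=> N /(_ i j); rewrite !eqxx.
Qed.

(** Properness of f turns the continuity of its inverse g into continuity of f:
    g maps compact sets to closed sets.  It also lets the inclusion f(A) <= B
    be checked on a dense part A0 of A, because the g-image of a compact part
    of B is closed and hence contains the limits of the points of A0. *)
Lemma proper_inverse_continuous (X Y : topologicalType) (A A0 : set X)
    (B : set Y) (f : X -> Y) (g : Y -> X) :
  hausdorff_space X ->
  {within B, continuous g} ->
  (forall y, B y -> f (g y) = y) -> (forall x, A x -> g (f x) = x) ->
  A0 `<=` A -> A `<=` closure A0 -> (forall x, A0 x -> B (f x)) ->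
  (forall x, A x -> exists K, [/\ compact K, K `<=` B &
     \forall z \near x, A z -> B (f z) -> K (f z)]) ->
  (forall x, A x -> B (f x)) /\ {within A, continuous f}.
Proof.
move=> hX cg fgK gfK A0A Acl A0B prop.
have clgK K : compact K -> K `<=` B -> closed (g @` K).
  move=> cK KB; apply: compact_closed => //; apply: continuous_compact cK.
  exact: continuous_subspaceW KB cg.
have fAB x : A x -> B (f x).
  move=> Ax; have [K [cK KB nK]] := prop x Ax.
  suff [y Ky <-] : (g @` K) x by rewrite fgK; exact: KB.
  apply: (clgK K cK KB) => V nV.
  have [z [A0z [Vz Kz]]] := Acl x Ax _ (filterI nV nK).
  have Az := A0A _ A0z.
  exists z; split=> //; exists (f z); last exact: gfK.
  by apply: Kz => //; exact: A0B.
split=> //; apply/subspace_continuousP => x Ax W; rewrite nbhsE.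
case=> O [oO Ofx] OW.
have [K [cK KB nK]] := prop x Ax.
(* the points of A near x that f sends outside O lie in this closed set *)
have nC : nbhs x (~` (g @` (K `&` ~` O))).
  apply: open_nbhs_nbhs; split.
    apply: closed_openC; apply: clgK; last by move=> y [/KB].
    by apply: compact_closedI cK _; exact: open_closedC.
  by move=> [y [/KB By nOy] gyx]; apply: nOy; rewrite -(fgK y By) gyx.
suff : \forall z \near x, A z -> W (f z) by [].
near=> z => Az; apply: OW; apply: contrapT => nOz.
have : (~` (g @` (K `&` ~` O))) z by near: z.
apply; exists (f z); last exact: gfK.
by split=> //; move: Az (fAB z Az); near: z.
Unshelve. all: by end_near. Qed.

Lemma compact_cV_box (R : realType) m (a b : R) :
  compact [set v : 'cV[R]_m | forall k, a <= v k 0 <= b].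
Proof.
have := @rV_compact R m (fun=> `[a, b]%classic) (fun=> @segment_compact R a b).
move=> /(continuous_compact (f := fun v : 'rV[R]_m => v^T)) cK.
suff -> : [set v : 'cV[R]_m | forall k, a <= v k 0 <= b] =
  trmx @` [set v : 'rV[R]_m | forall i, `[a, b]%classic (v ord0 i)].
  apply: cK; apply: continuous_subspaceT => v.
  apply: (@cvg_mx _ _ (nbhs_filter v)) => i j.
  under eq_fun do rewrite mxE; rewrite mxE; exact: continuous_mx_coord.
apply/seteqP; split=> [v vab|_ [v vab <-] k] /=.
  exists v^T; last exact: trmxK.
  by move=> i; rewrite /= in_itv/= mxE.
by rewrite mxE; have := vab k; rewrite /= in_itv.
Qed.

Lemma homeomorphism_on_restrict (X Y : topologicalType) (A C : set X)
    (B D : set Y) (f : X -> Y) : homeomorphism_on A B f ->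
  (forall x, A x -> C x <-> D (f x)) -> homeomorphism_on (A `&` C) (B `&` D) f.
Proof.
move=> [g [[AB BA] gf fg cf cg]] CD; exists g; split.
- split=> [x [Ax Cx]|y [By Dy]]; first by split; [exact: AB|exact/CD].
  by split; [exact: BA|apply/(CD _ (BA y By)); rewrite fg].
- by move=> x [Ax _]; exact: gf.
- by move=> y [By _]; exact: fg.
- by apply: continuous_subspaceW cf => x [].
- by apply: continuous_subspaceW cg => x [].
Qed.

Lemma smooth_on_sub (R : realType) (E W : normedModType R) (A A' : set E)
  (f : E -> W) : A' `<=` A -> smooth_on A f -> smooth_on A' f.
Proof.
move=> A'A sf x /A'A Ax; have [U [g [oU Ux gk gf]]] := sf x Ax.
by exists U, g; split=> // y Uy /A'A; exact: gf.
Qed.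

Lemma diffeomorphism_on_restrict (R : realType) (E W : normedModType R)
    (A C : set E) (B D : set W) (f : E -> W) : diffeomorphism_on A B f ->
  (forall x, A x -> C x <-> D (f x)) -> diffeomorphism_on (A `&` C) (B `&` D) f.
Proof.
move=> [g [[AB BA] gf fg cf cg]] CD; exists g; split.
- split=> [x [Ax Cx]|y [By Dy]]; first by split; [exact: AB|exact/CD].
  by split; [exact: BA|apply/(CD _ (BA y By)); rewrite fg].
- by move=> x [Ax _]; exact: gf.
- by move=> y [By _]; exact: fg.
- by apply: smooth_on_sub cf => x [].
- by apply: smooth_on_sub cg => x [].
Qed.

(** The inverse h' of h is continuous on the whole ambient space X', so the
    topology that the image inherits from X' is that of A. *)
Lemma homeomorphism_on_image (X X' Y : topologicalType) (A : set X) (B : set Y)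
    (h : X -> X') (h' : X' -> X) (f : X' -> Y) :
  continuous h -> continuous h' -> (forall x, h' (h x) = x) ->
  homeomorphism_on A B (f \o h) -> homeomorphism_on (h @` A) B f.
Proof.
move=> ch ch' h'K [g [[AB BA] gf fg cf cg]]; exists (h \o g); split.
- split=> [_ [x Ax <-]|y By]; first exact: AB.
  by exists (g y) => //; exact: BA.
- by move=> _ [x Ax <-] /=; congr h; exact: gf.
- by move=> y By; exact: fg.
- apply/subspace_continuousP => _ [x Ax <-] V fV.
  have nA : nbhs x [set z | A z -> V (f (h z))].
    by have /subspace_continuousP/(_ x Ax) := cf; apply.
  have nh : nbhs (h' (h x)) [set z | A z -> V (f (h z))] by rewrite h'K.
  suff : nbhs (h x) [set x' | (h @` A) x' -> V (f x')] by [].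
  have {}nh := ch' (h x) _ nh; apply: (@filterS _ _ (nbhs_filter (h x)) _ _ _ nh).
  move=> x' /= Vx' [z Az zx'].
  by move: Vx'; rewrite -zx' h'K; exact.
- apply/subspace_continuousP => y By.
  have /subspace_continuousP/(_ y By) cgy := cg.
  by apply: cvg_comp cgy _; exact: ch.
Qed.

(** * Interlacing and the signs of the weights *)

Section Interlacing.
Variables (R : realFieldType) (n m s : nat).
Implicit Types (lam d q : 'cV[R]_n) (mu : 'cV[R]_m).

(** The shift s counts the mu_k that are bounded from above only: s = 0
    describes the polytope of F, where m = n, and s = 1 that of G, where
    m = n + 1. *)
Definition interlacing lam mu := forall (j : 'I_n) (k : 'I_m),
  ((k < j + s)%N -> mu k 0 <= lam j 0) /\ ((j + s <= k)%N -> lam j 0 <= mu k 0).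

(** Minus the residue at lam_j of the rational function
    prod_k (x - mu_k) / prod_i (x - lam_i): the square of the j-th coordinate of
    the vector whose perturbation has spectrum mu. *)
Definition weight lam mu (j : 'I_n) :=
  - (\prod_(k < m) (lam j 0 - mu k 0)
     / \prod_(i < n | i != j) (lam j 0 - lam i 0)).

Lemma prod_sign (I : finType) (P : pred I) (a : I -> R) :
  \prod_(i | P i) a i =
  (-1) ^+ #|[pred i | P i & a i < 0]| * \prod_(i | P i) `|a i|.
Proof.
have -> : #|[pred i | P i & a i < 0]| = (\sum_(i | P i) (a i < 0)%R)%N.
  by rewrite -sum1_card big_mkcondr; apply: eq_bigr => i _; case: (a i < 0).
rewrite -prodrXr -big_split; apply: eq_bigr => i _.
exact: numEsign.
Qed.

Lemma card_ord_ge p t : #|[pred k : 'I_p | (t <= k)%N]| = (p - t)%N.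
Proof.
have -> : #|[pred k : 'I_p | (t <= k)%N]| = (\sum_(k < p) (t <= k))%N.
  by rewrite -sum1_card big_mkcond; apply: eq_bigr => k _; rewrite inE; case: leqP.
elim: p => [|p IH]; first by rewrite big_ord0.
by rewrite big_ord_recr/= IH; case: (leqP t p); lia.
Qed.

Definition above lam mu (j : 'I_n) : {set 'I_m} :=
  [set k | lam j 0 < mu k 0].

Hypothesis mE : m = (n + s)%N.

Section Sign.
Variable lam : 'cV[R]_n.
Hypothesis lam_incr : forall i j : 'I_n, (i < j)%N -> lam i 0 < lam j 0.

Lemma lam_lt i j : (lam i 0 < lam j 0) = (i < j)%N.
Proof.
apply/idP/idP => [|/lam_incr//]; apply: contraTT; rewrite -leqNgt -leNgt.
by rewrite leq_eqVlt => /predU1P[/val_inj->//|/lam_incr/ltW].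
Qed.

Lemma lam_sub_neq0 i j : i != j -> lam j 0 - lam i 0 != 0.
Proof.
by move=> ij; rewrite subr_eq0 neq_lt !lam_lt -neq_ltn eq_sym; exact: ij.
Qed.

(** The denominator of the weight has the sign (-1)^(n-1-j), so the sign of
    the weight is governed by the number of mu_k lying above lam_j. *)
Lemma weight_sign mu j : exists2 c,
  (c > 0) = [forall k, mu k 0 != lam j 0] /\ 0 <= c
  & weight lam mu j = (-1) ^+ (#|above lam mu j| + (n - j)) * c.
Proof.
rewrite /weight prod_sign (prod_sign (fun i => i != j)).
set N1 := #|_|; set N2 := #|_|; set A := \prod_(k < m) _; set B := \prod_(i | _) _.
have -> : N1 = #|above lam mu j|.
  by rewrite /N1; apply: eq_card => k; rewrite !inE subr_lt0.
have -> : (n - j)%N = N2.+1.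
  have -> : N2 = (n - j.+1)%N.
    rewrite -card_ord_ge; apply: eq_card => k; rewrite !inE subr_lt0 lam_lt.
    by rewrite -(inj_eq val_inj) /=; lia.
  by have := ltn_ord j; lia.
have A0 : 0 <= A by apply: prodr_ge0.
have B0 : 0 < B by apply: prodr_gt0 => i /lam_sub_neq0; rewrite normr_gt0.
exists (A / B); last first.
  by rewrite invfM -exprVn invrN invr1 mulrACA -exprD addnS exprS mulN1r mulNr.
split; last by rewrite divr_ge0// ltW.
rewrite pmulr_lgt0 ?invr_gt0//; apply/idP/forallP => [A1 k|A1].
  apply: contraL A1 => /eqP kj; rewrite -leNgt /A (bigD1 k)//= kj subrr normr0.
  by rewrite mul0r.
by apply: prodr_gt0 => k _; rewrite normr_gt0 subr_eq0 eq_sym.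
Qed.

Lemma above_interlacing mu j : interlacing lam mu ->
  (forall k, mu k 0 != lam j 0) -> #|above lam mu j| = (n - j)%N.
Proof.
move=> itl neq; have -> : (n - j = m - (j + s))%N by rewrite mE; lia.
rewrite -card_ord_ge; apply: eq_card => k; rewrite !inE.
have [lo hi] := itl j k.
have [ks|ks] := leqP (j + s) k; last by rewrite ltNge lo.
by rewrite lt_neqAle eq_sym neq hi.
Qed.

(** There are n - j of the mu above lam_j, so the two sign factors agree. *)
Lemma weight_gt0 mu j : interlacing lam mu ->
  (forall k, mu k 0 != lam j 0) -> 0 < weight lam mu j.
Proof.
move=> itl neq; have [c [c0 _] ->] := weight_sign mu j.
rewrite above_interlacing// addnn -muln2 mulnC exprM sqrrN expr1n expr1n mul1r c0.
exact/forallP.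
Qed.

Lemma weight_ge0 mu j : interlacing lam mu -> 0 <= weight lam mu j.
Proof.
move=> itl; have [/forallP/weight_gt0 w0|] := boolP [forall k, mu k 0 != lam j 0].
  exact/ltW/w0.
rewrite negb_forall => /existsP[k]; rewrite negbK => /eqP kj.
by rewrite /weight (bigD1 k)//= kj subrr !mul0r oppr0.
Qed.

Lemma weight_gt0_neq mu j k : 0 < weight lam mu j -> mu k 0 != lam j 0.
Proof.
apply: contraTneq => kj.
by rewrite /weight (bigD1 k)//= kj subrr !mul0r oppr0 ltxx.
Qed.

Hypothesis s_le1 : (s <= 1)%N.

(** Positive weights force consecutive counts of mu above lam_j to have
    opposite parities, while the counts decrease with j, start at most at
    n + 1 and end, being odd, at least at 1.  Descending from j = n - 1 gives
    the lower bound n - j, ascending from j = 0 the upper one. *)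
Lemma card_above mu j : (forall i, 0 < weight lam mu i) ->
  #|above lam mu j| = (n - j)%N.
Proof.
move=> w0.
pose N i := #|above lam mu i|; rewrite -[LHS]/(N j).
have par i : odd (N i) = odd (n - i).
  have [c [_ c0] wE] := weight_sign mu i; have := w0 i; rewrite wE.
  rewrite -signr_odd oddD -/(N i); case: odd; case: odd => //=.
    by rewrite expr1 mulN1r oppr_gt0 ltNge c0.
  by rewrite expr1 mulN1r oppr_gt0 ltNge c0.
have mono (i i' : 'I_n) : (i <= i')%N -> (N i' <= N i)%N.
  move=> ii'; apply: subset_leq_card; apply/fintype.subsetP => k; rewrite !inE.
  by apply: le_lt_trans; rewrite leNgt lam_lt -leqNgt.
have Nm i : (N i <= n + s)%N by rewrite -mE -[m in leqRHS]card_ord max_card.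
move: N par mono Nm => N par mono Nm.
have lower t : forall i : 'I_n, (n - i = t.+1)%N -> (t.+1 <= N i)%N.
  elim: t => [|t IH] i iE; first by have := par i; rewrite iE; lia.
  have i1 : (i.+1 < n)%N by lia.
  have i1E : (n - i.+1 = t.+1)%N by lia.
  have := IH (Ordinal i1) i1E; have := mono i (Ordinal i1) (leqnSn _).
  by have := par i; have := par (Ordinal i1) => /=; rewrite iE i1E; lia.
have upper t : forall i : 'I_n, i = t :> nat -> (N i <= n - i)%N.
  elim: t => [|t IH] i iE; first by have := par i; have := Nm i; lia.
  have i1 : (t < n)%N by have := ltn_ord i; lia.
  have ti : (t <= i)%N by lia.
  have := IH (Ordinal i1) erefl; have := mono (Ordinal i1) i ti.
  by have := par i; have := par (Ordinal i1) => /=; have := ltn_ord i; lia.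
apply/eqP; rewrite eqn_leq (upper j)//=.
have nj : (n - j = (n - j).-1.+1)%N by have := ltn_ord j; lia.
by rewrite nj; exact: lower nj.
Qed.

(** As mu is sorted, the number of mu_k above lam_j tells which ones they are. *)
Lemma interlacing_of_weight_gt0 mu :
  (forall k l : 'I_m, (k <= l)%N -> mu k 0 <= mu l 0) ->
  (forall j, 0 < weight lam mu j) -> interlacing lam mu.
Proof.
move=> mu_sort w0 j k; have cE := card_above j w0; have jn := ltn_ord j.
have [kj|kj] := ltP (lam j 0) (mu k 0); split=> // ks;
  rewrite ?(ltW kj)//; exfalso.
  suff : (m - k <= #|above lam mu j|)%N by rewrite cE; have := ltn_ord k; lia.
  rewrite -card_ord_ge; apply: subset_leq_card; apply/fintype.subsetP => l.
  by rewrite !inE => kl; apply: lt_le_trans kj _; exact: mu_sort.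
suff : (#|above lam mu j| <= m - k.+1)%N by rewrite cE; have := ltn_ord k; lia.
rewrite -card_ord_ge; apply: subset_leq_card; apply/fintype.subsetP => l.
rewrite !inE => kl; rewrite ltnNge; apply/negP => lk.
by have := lt_le_trans kl (le_trans (mu_sort l k lk) kj); rewrite ltxx.
Qed.

End Sign.
End Interlacing.

Section InterlacingOrder.
Variables (R : realType) (n m s : nat) (lam : 'cV[R]_n) (mu : 'cV[R]_m).
Hypotheses (mE : m = (n + s)%N) (s_le1 : (s <= 1)%N).
Hypothesis itl : interlacing s lam mu.

Lemma interlacing_between (k l : 'I_m) : (k < l)%N ->
  exists j : 'I_n, mu k 0 <= lam j 0 <= mu l 0.
Proof.
move=> kl; have ls : (l - s < n)%N by have := ltn_ord l; lia.
exists (Ordinal ls); have [lo _] := itl (Ordinal ls) k.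
have [_ hi] := itl (Ordinal ls) l.
by rewrite lo ?hi//=; lia.
Qed.

Lemma interlacing_sorted (k l : 'I_m) : (k <= l)%N -> mu k 0 <= mu l 0.
Proof.
rewrite leq_eqVlt => /predU1P[/val_inj->//|/interlacing_between[j /andP[kj jl]]].
exact: le_trans jl.
Qed.

Lemma interlacing_inj : (forall j k, mu k 0 != lam j 0) ->
  injective (fun k => mu k 0).
Proof.
move=> neq k l kl; apply/eqP; apply/negPn/negP.
rewrite -(inj_eq val_inj) neq_ltn => /orP[] /interlacing_between[j].
  by rewrite -kl -eq_le (negPf (neq j k)).
by rewrite kl -eq_le (negPf (neq j l)).
Qed.

End InterlacingOrder.

(** The columns of Q list the eigenvalues of S in an arbitrary order t. *)
Section PermutedNodes.
Variables (R : realFieldType) (n m : nat) (lam d : 'cV[R]_n) (t : 'S_n).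
Hypothesis dE : d = \col_j lam (t j) 0.

Lemma permuted_nodes_inj :
  (forall i j : 'I_n, (i < j)%N -> lam i 0 < lam j 0) ->
  injective (fun j => d j 0).
Proof.
move=> lam_incr i j; rewrite dE !mxE => ij; apply: (@perm_inj _ t); apply/eqP.
apply/negPn/negP; rewrite -(inj_eq val_inj) neq_ltn.
by move=> /orP[] /lam_incr; rewrite ij ltxx.
Qed.

Lemma weight_perm (mu : 'cV[R]_m) j : weight d mu j = weight lam mu (t j).
Proof.
rewrite /weight dE mxE; congr (- (_ / _)).
rewrite [RHS](reindex_inj (@perm_inj _ t)).
by apply: eq_big => i; rewrite ?mxE ?(inj_eq perm_inj).
Qed.

End PermutedNodes.

Section Polytope.
Variables (R : realType) (n m s : nat) (lam : 'cV[R]_n).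

Let P : set 'cV[R]_m := [set mu | interlacing s lam mu].

Lemma closed_interlacing : closed P.
Proof.
have -> : P = \bigcap_(jk in [set: 'I_n * 'I_m]) [set mu : 'cV[R]_m |
    if (jk.2 < jk.1 + s)%N then mu jk.2 0 <= lam jk.1 0
    else lam jk.1 0 <= mu jk.2 0].
  apply/seteqP; split=> [mu itl [j k] _ /=|mu itl j k].
    by have [lo hi] := itl j k; case: ltnP => [/lo|/hi].
  by have := itl (j, k) I => /=; case: ltnP.
have ck (k : 'I_m) : continuous (fun mu : 'cV[R]_m => mu k 0).
  by move=> mu; exact: coord_continuous.
apply: closed_bigI => -[j k] _ /=; case: (k < j + s)%N.
  by apply: (preimage_closed _ (@closed_le R (lam j 0))) => mu _; exact: ck.
by apply: (preimage_closed _ (@closed_ge R (lam j 0))) => mu _; exact: ck.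
Qed.

Lemma near_coord (mu : 'cV[R]_m) (Z : 'I_m -> set R) :
  (forall k, nbhs (mu k 0) (Z k)) ->
  nbhs mu [set nu : 'cV[R]_m | forall k, Z k (nu k 0)].
Proof.
move=> ZP.
apply: (@filter_forall _ _ (fun k (nu : 'cV[R]_m) => Z k (nu k 0))
  _ (nbhs_filter mu)) => k.
exact: (@coord_continuous R m 1 k 0 mu _ (ZP k)).
Qed.

Lemma nbhs_interlacing (mu : 'cV[R]_m) :
  P mu -> (forall j k, mu k 0 != lam j 0) -> nbhs mu P.
Proof.
move=> itl neq.
pose Z (k : 'I_m) : set R := [set x | forall j : 'I_n,
  ((k < j + s)%N -> x <= lam j 0) /\ ((j + s <= k)%N -> lam j 0 <= x)].
have : nbhs mu [set nu : 'cV[R]_m | forall k, Z k (nu k 0)].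
  apply: near_coord => k.
  apply: (@filter_forall _ _ (fun (j : 'I_n) (x : R) =>
    ((k < j + s)%N -> x <= lam j 0) /\ ((j + s <= k)%N -> lam j 0 <= x))
    _ (nbhs_filter (mu k 0))) => j.
  have [lo hi] := itl j k; have [kj|kj] := ltnP k (j + s).
    have : mu k 0 < lam j 0 by rewrite lt_neqAle neq lo.
    move=> lt; apply: (filterS _ (open_nbhs_nbhs (conj (@open_lt R (lam j 0)) lt))).
    by move=> x /ltW.
  have : lam j 0 < mu k 0 by rewrite lt_neqAle eq_sym neq hi.
  move=> gt; apply: (filterS _ (open_nbhs_nbhs (conj (@open_gt R (lam j 0)) gt))).
  by move=> x /ltW.
by apply: filterS => nu nuP j k; exact: nuP.
Qed.

Lemma interior_interlacing :
  interior P = [set mu | P mu /\ forall j k, mu k 0 != lam j 0].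
Proof.
apply/seteqP; split=> [mu Pmu|mu [itl neq]].
  have itl : P mu := nbhs_singleton Pmu; split=> // j k.
  apply/negP => /eqP muk.
  (* moving mu_k across lam_j leaves the polytope *)
  pose sg : R := if (k < j + s)%N then 1 else -1.
  pose move (t : R) : 'cV[R]_m := mu + (t * sg) *: delta_mx k 0.
  have cmove : continuous move.
    move=> t; apply: cvgD; first exact: cvg_cst.
    by apply: cvgZr_tmp; apply: cvgM; [exact: cvg_id|exact: cvg_cst].
  have move0 : move 0 = mu by rewrite /move mul0r scale0r addr0.
  have : nbhs (0 : R) (move @^-1` P) by apply: cmove; rewrite move0.
  move=> /nbhs_ballP[e /= e0 eP].
  have Pt : P (move (e / 2)).
    apply: eP; rewrite /ball/= sub0r normrN gtr0_norm ?divr_gt0//.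
    by rewrite ltr_pdivrMr// ltr_pMr// ltr1n.
  have := Pt j k; rewrite /move /sg !mxE !eqxx mulr1 muk.
  case: ltnP => _ [lo hi].
    by have := lo isT; rewrite mulr1 leNgt ltrDl divr_gt0.
  by have := hi isT; rewrite mulrN1 leNgt gtrDl oppr_lt0 divr_gt0.
exact: nbhs_interlacing.
Qed.

End Polytope.

(** * Secular polynomials *)

Section Secular.
Variable R : realFieldType.

Definition nodal p (v : 'cV[R]_p) : {poly R} := \prod_(k < p) ('X - (v k 0)%:P).

(** The characteristic polynomial of a diagonal matrix d after a rank-one
    perturbation (L = 1) or after bordering (L = 'X - c), with squared
    coordinates q. *)
Definition secular n (L : {poly R}) (d : 'cV[R]_n) (q : 'I_n -> R) : {poly R} :=
  L * nodal d - \sum_j q j *: \prod_(i < n | i != j) ('X - (d i 0)%:P).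

Lemma nodal_monic p (v : 'cV[R]_p) : nodal v \is monic.
Proof. exact: monic_prod_XsubC. Qed.

Lemma size_nodal p (v : 'cV[R]_p) : size (nodal v) = p.+1.
Proof. by rewrite /nodal size_prod_XsubC /index_enum -enumT size_enum_ord. Qed.

Lemma horner_nodal p (v : 'cV[R]_p) x : (nodal v).[x] = \prod_(k < p) (x - v k 0).
Proof. by rewrite horner_prod; apply: eq_bigr => k _; rewrite !hornerE. Qed.

Section Nodes.
Variables (n m : nat) (d : 'cV[R]_n).
Hypothesis d_inj : injective (fun i => d i 0).
Implicit Types (mu : 'cV[R]_m) (q : 'I_n -> R).

Lemma node_gap j : \prod_(i < n | i != j) (d j 0 - d i 0) != 0.
Proof.
apply/prodf_neq0 => i ij; rewrite subr_eq0; apply: contra ij => /eqP ji.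
by apply/eqP/d_inj.
Qed.

Lemma secular_horner L q j : (secular L d q).[d j 0] =
  - (q j * \prod_(i < n | i != j) (d j 0 - d i 0)).
Proof.
rewrite /secular hornerD hornerN hornerM horner_nodal (bigD1 j)//=.
rewrite subrr mul0r mulr0 sub0r; congr (- _).
rewrite horner_sum (bigD1 j)//= [X in _ + X]big1 ?addr0 => [|l lj].
  rewrite hornerZ horner_prod; congr (_ * _).
  by apply: eq_bigr => i _; rewrite !hornerE.
rewrite hornerZ horner_prod (bigD1 j)/=; last by rewrite eq_sym.
by rewrite hornerXsubC subrr mul0r mulr0.
Qed.

Lemma secular_weight L q mu j : nodal mu = secular L d q -> weight d mu j = q j.
Proof.
move=> muE; rewrite /weight -horner_nodal muE secular_horner.
by rewrite mulNr opprK mulfK// node_gap.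
Qed.

(** Both sides agree at the n nodes and differ by a polynomial of degree less
    than n. *)
Lemma secular_of_weight L mu : (size (nodal mu - L * nodal d)%R <= n)%N ->
  nodal mu = secular L d (weight d mu).
Proof.
move=> sz; apply/eqP; rewrite -subr_eq0; apply/eqP.
apply: (@roots_geq_poly_eq0 _ _ [seq d j 0 | j <- enum 'I_n]).
- apply/allP => _ /mapP[j _ ->]; rewrite /root hornerD hornerN secular_horner.
  by rewrite horner_nodal /weight mulNr divfK ?node_gap// !opprK subrr.
- by rewrite map_inj_uniq// enum_uniq.
rewrite size_map size_enum_ord /secular opprB addrCA addrC.
rewrite (leq_trans (size_polyD _ _))// geq_max sz /=.
apply: (leq_trans (size_sum _ _ _)); apply/bigmax_leqP => j _.
rewrite (leq_trans (size_scale_leq _ _))// -ltnS.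
have nE : nodal d = ('X - (d j 0)%:P)
    * \prod_(i < n | i != j) ('X - (d i 0)%:P).
  by rewrite /nodal [X in X = _](bigD1 j).
have -> : n.+1 = size (('X - (d j 0)%:P)
    * \prod_(i < n | i != j) ('X - (d i 0)%:P)) by rewrite -(size_nodal d) nE.
rewrite size_monicM ?monicXsubC// ?size_XsubC//.
by rewrite monic_neq0// monic_prod_XsubC.
Qed.

End Nodes.

Lemma size_nodalB n (d mu : 'cV[R]_n) : (size (nodal mu - 1 * nodal d)%R <= n)%N.
Proof.
rewrite mul1r; apply/leq_sizeP => i; rewrite leq_eqVlt => /predU1P[<-|ni].
  rewrite coefB; have := monicP (nodal_monic mu); have := monicP (nodal_monic d).
  by rewrite /lead_coef !size_nodal /= => -> ->; rewrite subrr.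
by rewrite nth_default// (leq_trans (size_polyD _ _))// size_polyN !size_nodal maxnn.
Qed.

Lemma nodal_coefPn p (v : 'cV[R]_p) : (0 < p)%N -> (nodal v)`_p.-1 = - \sum_k v k 0.
Proof.
move=> p0; pose s := [seq v k 0 | k <- index_enum 'I_p].
have sp : size s = p by rewrite size_map /index_enum -enumT size_enum_ord.
have := @coefPn_prod_XsubC _ s; rewrite sp -lt0n => /(_ p0).
by rewrite !big_map.
Qed.

(** The leading coefficients cancel, and the next ones do because of the
    prescribed sum. *)
Lemma size_nodal1B n (d : 'cV[R]_n) (mu : 'cV[R]_(n + 1)) c : (0 < n)%N ->
  \sum_j mu j 0 = \sum_k d k 0 + c ->
  (size (nodal mu - ('X - c%:P) * nodal d)%R <= n)%N.
Proof.
move=> n0 sumE.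
have sz : (size (nodal mu - ('X - c%:P) * nodal d)%R <= n.+1)%N.
  apply/leq_sizeP => i; rewrite leq_eqVlt => /predU1P[<-|ni]; last first.
    rewrite nth_default// (leq_trans (size_polyD _ _))// size_polyN.
    rewrite size_monicM ?monicXsubC// ?monic_neq0 ?nodal_monic// !size_nodal.
    by rewrite size_XsubC; lia.
  rewrite coefB; have M : ('X - c%:P) * nodal d \is monic.
    by rewrite monicMl ?monicXsubC// nodal_monic.
  have -> : (('X - c%:P) * nodal d)`_n.+1 = 1.
    rewrite -[RHS](monicP M) /lead_coef size_monicM ?monicXsubC//.
      by rewrite size_nodal size_XsubC.
    by rewrite monic_neq0 ?nodal_monic.
  have -> : (nodal mu)`_n.+1 = 1.
    rewrite -[RHS](monicP (nodal_monic mu)) /lead_coef size_nodal /=.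
    by congr (_`_ _); lia.
  by rewrite subrr.
apply/leq_sizeP => i; rewrite leq_eqVlt => /predU1P[<-|ni]; last first.
  by rewrite nth_default// (leq_trans sz).
rewrite coefB mulrBl coefB coefXM coefCM gtn_eqF// nodal_coefPn//.
have -> : (nodal d)`_n = 1.
  by rewrite -[RHS](monicP (nodal_monic d)) /lead_coef size_nodal.
have -> : (nodal mu)`_n = - \sum_k mu k 0.
  by rewrite -nodal_coefPn ?addn1//; congr (_`_ _); lia.
by rewrite sumE; ring.
Qed.

End Secular.

(** * The spectral map of an interlacing problem *)

(** The setting common to F and G.  The parameter space E has coordinates crd,
    which the direction u shifts uniformly; f e is the sorted sequence of roots
    of the secular polynomial with squared coordinates of e; g is the candidate
    inverse; and b is a continuous bound on the spectra, which makes f proper. *)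
Section Core.
Variables (R : realType) (E : normedModType R) (n m s : nat).
Variables (lam d : 'cV[R]_n) (t : 'S_n).
Hypotheses (mE : m = (n + s)%N) (s_le1 : (s <= 1)%N).
Hypothesis lam_incr : forall i j : 'I_n, (i < j)%N -> lam i 0 < lam j 0.
Hypothesis dE : d = \col_j lam (t j) 0.
Variables (crd : E -> 'cV[R]_n) (u : E) (f : E -> 'cV[R]_m) (g : 'cV[R]_m -> E).
Variables (L : E -> {poly R}) (b : E -> R).
Hypothesis crd_cont : forall j, continuous (fun e => crd e j 0).
Hypothesis crd_shift : forall e x j, crd (e + x *: u) j 0 = crd e j 0 + x.
Hypothesis f_sort :
  forall e (k l : 'I_m), (k <= l)%N -> f e k 0 <= f e l 0.
Hypothesis f_char : forall e,
  nodal (f e) = secular (L e) d (fun j => crd e j 0 ^+ 2).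
Hypothesis f_smooth : forall l k, Ck k setT (fun e => (nodal (f e))`_l).
Hypothesis g_crd : forall mu j, crd (g mu) j 0 = Num.sqrt (weight d mu j).
Hypothesis g_cont : continuous g.
Hypothesis g_smooth : forall k (U : set 'cV[R]_m), open U ->
  (forall mu j, U mu -> 0 < weight d mu j) -> Ck k U g.
Hypothesis fK : forall e, (forall j, 0 <= crd e j 0) -> g (f e) = e.
Hypothesis gK : forall mu, interlacing s lam mu -> f (g mu) = mu.
Hypothesis b_cont : continuous b.
Hypothesis f_bound :
  forall e, interlacing s lam (f e) -> forall k, `|f e k 0| <= b e.

Let A : set E := [set e | forall j, 0 <= crd e j 0].
Let A0 : set E := [set e | forall j, 0 < crd e j 0].
Let P : set 'cV[R]_m := [set mu | interlacing s lam mu].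

Let d_inj : injective (fun j => d j 0).
Proof. exact: permuted_nodes_inj dE lam_incr. Qed.

Let f_weight e j : weight d (f e) j = crd e j 0 ^+ 2.
Proof. exact: (secular_weight d_inj j (f_char e)). Qed.

Let A0A : A0 `<=` A.
Proof. by move=> e e0 j; exact/ltW/e0. Qed.

Let openA0 : open A0.
Proof.
rewrite openE => e e0.
apply: (@filter_forall _ _ (fun j e => 0 < crd e j 0) _ (nbhs_filter e)) => j.
exact: (crd_cont (open_nbhs_nbhs (conj (@open_gt R 0) (e0 j)))).
Qed.

(* Shifting by a small positive multiple of u makes all coordinates positive. *)
Let A_closure : A `<=` closure A0.
Proof.
move=> e Ae V nV.
have cmove : continuous (fun x : R => e + x *: u).
  move=> x; apply: cvgD; first exact: cvg_cst.
  by apply: cvgZr_tmp; exact: cvg_id.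
have : nbhs (0 : R) [set x | V (e + x *: u)].
  by apply: cmove; rewrite /= scale0r addr0.
move=> /nbhs_ballP[r /= r0 rV]; exists (e + (r / 2) *: u); split.
  by move=> j; rewrite crd_shift ltr_wpDl// divr_gt0.
apply: rV; rewrite /ball/= sub0r normrN gtr0_norm ?divr_gt0//.
by rewrite ltr_pdivrMr// ltr_pMr// ltr1n.
Qed.

Let fA0 e : A0 e -> interlacing s lam (f e).
Proof.
move=> e0; apply: (interlacing_of_weight_gt0 mE lam_incr s_le1) => [k l|j].
  exact: f_sort.
have := weight_perm dE (f e) ((t^-1)%g j); rewrite permKV f_weight => <-.
by rewrite exprn_gt0.
Qed.

Let f_homeo : (forall e, A e -> P (f e)) /\ {within A, continuous f}.
Proof.
apply: (@proper_inverse_continuous _ _ A A0 P f g) => //.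
- exact: continuous_subspaceT.
- move=> e Ae; exists (P `&` [set v | forall k, - (b e + 1) <= v k 0 <= b e + 1]).
  split; [|by move=> ? []|].
    rewrite setIC; apply: compact_closedI; first exact: compact_cV_box.
    exact: closed_interlacing.
  have bP : \forall z \near e, b z < b e + 1.
    by apply: cvgr_lt (b_cont (x := e)) _ _; rewrite ltrDl.
  near=> z => Az Pfz; split=> // k; rewrite -ler_norml.
  by apply: le_trans (f_bound Pfz k) _; apply/ltW; near: z.
Unshelve. all: by end_near. Qed.

Let core_homeomorphism : homeomorphism_on A P f.
Proof.
have [AP cf] := f_homeo; exists g; split=> //; last exact: continuous_subspaceT.
split=> // mu _ j; rewrite g_crd; exact: sqrtr_ge0.
Qed.

Let core_diffeomorphism : diffeomorphism_on A0 (interior P) f.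
Proof.
have [AP cf] := f_homeo; have PE := interior_interlacing m s lam.
have wP mu j : (interior P) mu -> 0 < weight d mu j.
  rewrite /P PE => -[itl neq]; rewrite (weight_perm dE).
  by apply: (weight_gt0 mE lam_incr itl).
have A0P e : A0 e -> (interior P) (f e).
  move=> e0; rewrite /P PE; split=> [|j k]; first exact: fA0.
  apply: weight_gt0_neq.
  have := weight_perm dE (f e) ((t^-1)%g j); rewrite permKV f_weight => <-.
  by rewrite exprn_gt0.
exists g; split.
- split=> // mu Pmu j; rewrite g_crd sqrtr_gt0; exact: wP.
- by move=> e /A0A; exact: fK.
- by move=> mu /interior_subset; exact: gK.
- move=> e e0; exists A0, f; split=> // k.
  apply: (Ck_simple_roots (chi := fun e => nodal (f e))) => //.
  + by move=> l k'; exact: Ck_subset (@subsetT _ A0) (f_smooth l k').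
  + move=> i x x0.
    have := continuous_subspaceW A0A cf; rewrite continuous_open_subspace//.
    move=> /(_ x (mem_set x0)) cfx.
    apply: (@cvg_comp _ _ _ f (fun M : 'cV[R]_m => M i 0) _ _ _ cfx).
    exact: coord_continuous.
  + move=> x /A0P; rewrite /P PE => -[itl neq].
    exact: (interlacing_inj mE s_le1 itl neq).
- move=> mu Pmu; exists (interior P), g; split=> //; first exact: open_interior.
  by move=> k; apply: g_smooth => //; exact: open_interior.
Qed.

(** Properness takes care of the boundary of A.  In the interior the spectrum is
    simple, because any two mu_k are separated by some lam_j. *)
Theorem spectral_map_homeo_diffeo :
  homeomorphism_on A P f /\ diffeomorphism_on A0 (interior P) f.
Proof. by split. Qed.

End Core.

Section InverseFormula.
Variables (R : realType) (n m : nat) (d : 'cV[R]_n).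

Definition inverse_coords (mu : 'cV[R]_m) : 'cV[R]_n :=
  \col_j Num.sqrt (weight d mu j).

Lemma Ck_linear_map (E W : normedModType R) (U : set E) k (F : E -> W) :
  open U -> linear F -> continuous F -> Ck k U F.
Proof.
move=> oU linF cF; pose FM := GRing.isLinear.Build _ _ _ _ _ linF.
pose L : {linear E -> W} := HB.pack F FM.
exact: (@Ck_linear _ _ _ oU _ _ L).
Qed.

Lemma Ck_coord (U : set 'cV[R]_m) k i : open U -> Ck k U (fun mu => mu i 0).
Proof.
move=> oU; apply: Ck_linear_map => //; last exact: coord_continuous.
by move=> a x y; rewrite !mxE.
Qed.

Lemma Ck_weight (U : set 'cV[R]_m) k j : open U -> Ck k U (fun mu => weight d mu j).
Proof.
move=> oU; apply: CkN => //; apply: CkM => //; last exact: Ck_cst.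
apply: Ck_prod => // i _; apply: CkB => //; first exact: Ck_cst.
exact: Ck_coord.
Qed.

Lemma continuous_inverse_coords : continuous inverse_coords.
Proof.
move=> mu; apply: (@cvg_mx _ _ (nbhs_filter mu)) => j i; rewrite !ord1 mxE.
have -> : (fun nu => inverse_coords nu j 0) = Num.sqrt \o (fun nu => weight d nu j).
  by apply/funext => nu; rewrite mxE.
have cw : {for mu, continuous (fun nu => weight d nu j)}.
  exact: (Ck_weight 0 j (@openT 'cV[R]_m)).
by apply: (@cvg_comp _ _ _ _ Num.sqrt _ _ _ cw); exact: sqrt_continuous.
Qed.

Lemma Ck_inverse_coords (U : set 'cV[R]_m) k : open U ->
  (forall mu j, U mu -> 0 < weight d mu j) -> Ck k U inverse_coords.
Proof.
move=> oU w0; apply: Ck_cV => // j.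
apply: (@Ck_eq _ _ _ oU _ _ (fun mu => Num.sqrt (weight d mu j))).
  by move=> mu _; rewrite mxE.
by apply: Ck_sqrt => [//|mu Umu|]; [exact: w0|exact: Ck_weight].
Qed.

Lemma Ck_secular_coef (E : normedModType R) (L : E -> {poly R})
    (q : E -> 'I_n -> R) l k :
  Ck k setT (fun e => (L e * nodal d)`_l) ->
  (forall j, Ck k setT (fun e => q e j)) ->
  Ck k setT (fun e => (secular (L e) d (q e))`_l).
Proof.
have oT : open [set: E] := openT.
move=> CL Cq.
pose P j := \prod_(i < n | i != j) ('X - (d i 0)%:P).
apply: (@Ck_eq _ _ _ oT _ _ (fun e => (L e * nodal d)`_l - \sum_j q e j * (P j)`_l)).
  move=> e _; rewrite /secular coefB coef_sum; congr (_ - _).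
  by apply: eq_bigr => j _; rewrite coefZ.
apply: CkB => //; apply: Ck_sum => // j _; apply: CkM => //; exact: Ck_cst.
Qed.

End InverseFormula.

Section Polyhedra.
Variables (R : realType) (n : nat) (lam : 'cV[R]_n).
Hypothesis lam_incr : forall i j : 'I_n, (i < j)%N -> lam i 0 < lam j 0.

Let lam_le (i j : 'I_n) : (i <= j)%N -> lam i 0 <= lam j 0.
Proof. by rewrite leq_eqVlt => /predU1P[/val_inj->//|/lam_incr/ltW]. Qed.

Lemma polyF_interlacing : polyF lam = [set mu : 'cV[R]_n | interlacing 0 lam mu].
Proof.
apply/seteqP; split=> [mu muP j k|mu itl k]; last first.
  split=> [|j jk]; first by have [_] := itl k k; apply; rewrite addn0.
  by have [+ _] := itl j k; apply; rewrite addn0 jk.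
rewrite addn0; have [lo hi] := muP k; split=> [kj|jk].
  have k1 : (k.+1 < n)%N by have := ltn_ord j; lia.
  by apply: le_trans (hi (Ordinal k1) erefl) _; exact: lam_le.
exact: le_trans (lam_le jk) lo.
Qed.

Lemma polyG_interlacing :
  polyG lam = [set mu : 'cV[R]_(n + 1) | interlacing 1 lam mu].
Proof.
apply/seteqP; split=> [mu muP j k|mu itl k]; last first.
  split=> j jk; first by have [_] := itl j k; apply; lia.
  by have [+ _] := itl j k; apply; lia.
have [lo hi] := muP k; split=> [kj|jk].
  have k1 : (k < n)%N by have := ltn_ord j; lia.
  by apply: le_trans (hi (Ordinal k1) erefl) _; apply: lam_le => /=; lia.
have k1 : (k.-1 < n)%N by have := ltn_ord k; lia.
have kE : k.-1.+1 = k :> nat by lia.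
apply: le_trans (lo (Ordinal k1) kE); apply: lam_le => /=; lia.
Qed.

End Polyhedra.

(** * Determinants of arrow matrices *)

Section Arrow.
Variables (K : idomainType) (n : nat).

(** Right multiplication by a block upper triangular matrix of determinant
    prod e clears the last column above the corner; the factor is then
    cancelled. *)
Lemma det_arrow (e : 'rV[K]_n) (u : 'cV[K]_n) (w : 'rV[K]_n) c :
  (forall i, e 0 i != 0) ->
  \det (block_mx (diag_mx e) u w c%:M : 'M[K]_(n + 1)) =
  c * \prod_i e 0 i - \sum_j (w 0 j * u j 0) * \prod_(i | i != j) e 0 i.
Proof.
move=> e0; set p := \prod_i e 0 i.
have p0 : p != 0 by apply/prodf_neq0.
pose z : 'cV[K]_n := \col_j (- (u j 0 * \prod_(i | i != j) e 0 i)).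
have ez : diag_mx e *m z + u *m p%:M = 0.
  apply/colP => j; rewrite mul_diag_mx mul_mx_scalar !mxE.
  have -> : p = e 0 j * \prod_(i | i != j) e 0 i by rewrite /p (bigD1 j).
  by ring.
have AB : block_mx (diag_mx e) u w c%:M *m block_mx 1%:M z 0 (p%:M : 'M[K]_1) =
    block_mx (diag_mx e) 0 w (w *m z + c%:M *m p%:M).
  by rewrite mulmx_block !mulmx1 !mulmx0 !addr0 ez.
apply: (mulIf p0); have := congr1 determinant AB.
rewrite det_mulmx det_ublock det1 mul1r det_scalar1 => ->.
rewrite det_lblock det_diag -/p mulrC; congr (_ * _).
rewrite -scalar_mxM det_mx11 !mxE mulr1n addrC; congr (_ + _).
by rewrite -sumrN; apply: eq_bigr => j _; rewrite !mxE; ring.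
Qed.

(** The matrix diag e - u w is the Schur complement of the corner 1 in an arrow
    matrix. *)
Lemma det_diagB_rank_one (e : 'rV[K]_n) (u : 'cV[K]_n) (w : 'rV[K]_n) :
  (forall i, e 0 i != 0) ->
  \det (diag_mx e - u *m w) =
  \prod_i e 0 i - \sum_j (w 0 j * u j 0) * \prod_(i | i != j) e 0 i.
Proof.
move=> e0; rewrite -[X in _ = X - _]mul1r -det_arrow//.
have -> : block_mx (diag_mx e) u w 1%:M =
    block_mx (diag_mx e - u *m w) u 0 1%:M *m block_mx 1%:M 0 w (1%:M : 'M[K]_1).
  by rewrite mulmx_block !mulmx1 !mulmx0 !mul1mx !add0r subrK.
by rewrite det_mulmx det_ublock det_lblock !det1 !mulr1.
Qed.

End Arrow.

Section CharPolyArrow.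
Variables (K : idomainType) (n : nat).

Let charE (d : 'rV[K]_n) : char_poly_mx (diag_mx d) =
  diag_mx (\row_i ('X - (d 0 i)%:P)).
Proof.
apply/matrixP => i j; rewrite !mxE; case: eqVneq => //= _.
by rewrite polyC0 subr0.
Qed.

Let char_neq0 (d : 'rV[K]_n) i : (\row_i ('X - (d 0 i)%:P)) 0 i != 0.
Proof. by rewrite mxE polyXsubC_eq0. Qed.

Lemma char_poly_arrow (d : 'rV[K]_n) (u : 'cV[K]_n) (w : 'rV[K]_n) c :
  char_poly (block_mx (diag_mx d) u w c%:M : 'M[K]_(n + 1)) =
  ('X - c%:P) * \prod_i ('X - (d 0 i)%:P)
  - \sum_j (w 0 j * u j 0) *: \prod_(i | i != j) ('X - (d 0 i)%:P).
Proof.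
have -> : char_poly (block_mx (diag_mx d) u w c%:M : 'M[K]_(n + 1)) =
  \det (block_mx (diag_mx (\row_i ('X - (d 0 i)%:P))) (- map_mx polyC u)
     (- map_mx polyC w) (('X - c%:P)%:M : 'M[{poly K}]_1)).
  rewrite /char_poly -charE /char_poly_mx map_block_mx/= scalar_mx_block.
  rewrite opp_block_mx add_block_mx !add0r; congr (\det (block_mx _ _ _ _)).
  by rewrite map_scalar_mx/= raddfB.
rewrite det_arrow; last exact: char_neq0.
congr (_ * _ - _); first by apply: eq_bigr => i _; rewrite mxE.
apply: eq_bigr => j _; rewrite !mxE mulrNN -polyCM mul_polyC; congr (_ *: _).
by apply: eq_bigr => i _; rewrite mxE.
Qed.

Lemma char_poly_diagD_rank_one (d : 'rV[K]_n) (u : 'cV[K]_n) (w : 'rV[K]_n) :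
  char_poly (diag_mx d + u *m w) =
  \prod_i ('X - (d 0 i)%:P)
  - \sum_j (w 0 j * u j 0) *: \prod_(i | i != j) ('X - (d 0 i)%:P).
Proof.
have -> : char_poly (diag_mx d + u *m w) =
  \det (diag_mx (\row_i ('X - (d 0 i)%:P)) - map_mx polyC u *m map_mx polyC w).
  by rewrite /char_poly -charE /char_poly_mx map_mxD/= map_mxM/= opprD addrA.
rewrite det_diagB_rank_one; last exact: char_neq0.
congr (_ - _); first by apply: eq_bigr => i _; rewrite mxE.
apply: eq_bigr => j _; rewrite !mxE -polyCM mul_polyC; congr (_ *: _).
by apply: eq_bigr => i _; rewrite mxE.
Qed.

End CharPolyArrow.

Lemma char_poly_sim (K : comNzRingType) n (P P' A : 'M[K]_n) :
  P' *m P = 1%:M -> char_poly (P *m A *m P') = char_poly A.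
Proof.
move=> P'P; have PP' := mulmx1C P'P.
have PPp : map_mx polyC P *m map_mx polyC P' = 1%:M.
  by rewrite -map_mxM/= PP' map_mx1.
rewrite /char_poly; have -> : char_poly_mx (P *m A *m P') =
    map_mx polyC P *m char_poly_mx A *m map_mx polyC P'.
  rewrite /char_poly_mx !map_mxM/= mulmxBr mulmxBl; congr (_ - _).
  by rewrite mul_mx_scalar -scalemxAl PPp scalemx1.
by rewrite !det_mulmx mulrAC -det_mulmx PPp det1 mul1r.
Qed.

(** * Spectra of Hermitian matrices *)

Lemma exists_sorting_perm (R : realDomainType) n (v : 'I_n -> R) :
  exists p : 'S_n, forall k l : 'I_n, (k <= l)%N -> v (p k) <= v (p l).
Proof.
pose s := sort <=%R (codom v).
have ss : size s == n by rewrite size_sort size_codom card_ord.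
have /tuple_permP[p pE] : perm_eq (Tuple ss) [tuple v i | i < n].
  by rewrite /= perm_sort /= /codom /image_mem enumT.
have sE k : s`_(nat_of_ord k) = v (p k).
  by rewrite (pE : s = _) -tnth_nth !tnth_mktuple.
exists p => k l kl; rewrite -!sE.
apply: (sorted_leq_nth le_trans le_refl) => //; rewrite ?inE ?(eqP ss)//.
exact: sort_le_sorted.
Qed.

Section Spectrum.
Variable R : realType.
Local Notation toC := (real_complex R).

Lemma map_nodal n (mu : 'cV[R]_n) :
  map_poly toC (nodal mu) = \prod_k ('X - ((mu k 0)%:C)%:P).
Proof.
rewrite rmorph_prod; apply: eq_bigr => k _.
by rewrite rmorphB/= map_polyX map_polyC.
Qed.

(** Unique factorization identifies the multiset of eigenvalues, and a multiset
    has only one nondecreasing enumeration. *)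
Lemma sigma_o_eq n (A : 'M[R[i]]_n) (mu : 'cV[R]_n) :
  char_poly A = map_poly toC (nodal mu) ->
  (forall k l : 'I_n, (k <= l)%N -> mu k 0 <= mu l 0) -> sigma_o A = mu.
Proof.
move=> AE mu_sort.
have sE : \prod_(z <- eigenvalue_seq A) ('X - z%:P) =
    \prod_(z <- [seq (mu k 0)%:C | k <- enum 'I_n]) ('X - z%:P).
  rewrite big_map big_enum -map_nodal -AE.
  rewrite /eigenvalue_seq; case: closed_field_poly_normal => s /= sE.
  by rewrite [RHS]sE (monicP (char_poly_monic A)) scale1r.
have pE : perm_eq [seq complex.Re z | z <- eigenvalue_seq A]
    [seq mu k 0 | k <- enum 'I_n].
  by have := perm_map (@complex.Re R) (prod_XsubC_eq sE); rewrite -map_comp.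
have nE k (kn : (k < n)%N) : [seq mu k 0 | k <- enum 'I_n]`_k = mu (Ordinal kn) 0.
  rewrite (nth_map (Ordinal kn)) ?size_enum_ord//; congr (mu _ 0).
  by apply/val_inj; rewrite /= nth_enum_ord.
apply/colP => j; rewrite mxE.
have -> : sort <=%R [seq complex.Re z | z <- eigenvalue_seq A] =
    [seq mu k 0 | k <- enum 'I_n].
  apply: (sorted_eq le_trans le_anti); rewrite ?perm_sort//.
    exact: sort_le_sorted.
  apply/(sortedP 0) => i; rewrite size_map size_enum_ord => i1.
  by rewrite (nE _ (ltnW i1)) (nE _ i1); exact: mu_sort.
by rewrite (nE _ (ltn_ord j)); congr (mu _ 0); exact/val_inj.
Qed.

(** Diagonalization by a unitary matrix gives all the symmetric functions of
    the spectrum that are used: the characteristic polynomial and the first two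
    power sums. *)
Lemma hermitian_spectrum n (A : 'M[R[i]]_n) (mu := sigma_o A) :
  A \is hermsymmx ->
  [/\ forall k l : 'I_n, (k <= l)%N -> mu k 0 <= mu l 0,
      char_poly A = map_poly toC (nodal mu),
      \tr A = (\sum_k mu k 0)%:C
    & \tr (A *m A) = (\sum_k mu k 0 ^+ 2)%:C].
Proof.
move=> Ah; have /orthomx_spectralP AE := hermitian_normalmx Ah.
have /mxOverP spR := hermitian_spectral_diag_real Ah.
have PU := spectral_unit A.
move: (spectral_diag A) (spectralmx A) AE spR PU => sp P AE spR PU.
have spE i : (complex.Re (sp 0 i))%:C = sp 0 i by apply: RRe_real; exact: spR.
have [p p_sort] := exists_sorting_perm (fun i => complex.Re (sp 0 i)).
pose nu := \col_k complex.Re (sp 0 (p k)).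
have nuE k : (nu k 0)%:C = sp 0 (p k) by rewrite mxE spE.
have PVP : P *m invmx P = 1%:M by rewrite mulmxV.
have nu_sort (k l : 'I_n) : (k <= l)%N -> nu k 0 <= nu l 0.
  by move=> kl; rewrite !mxE; exact: p_sort.
have chiE : char_poly A = map_poly toC (nodal nu).
  rewrite AE char_poly_sim// char_poly_trig; last exact: diag_mx_is_trig.
  rewrite map_nodal (reindex_inj (@perm_inj _ p)).
  by apply: eq_bigr => k _; rewrite nuE mxE eqxx.
have -> : mu = nu by exact: sigma_o_eq.
split=> //.
  rewrite AE -mulmxA mxtrace_mulC -mulmxA PVP mulmx1 mxtrace_diag rmorph_sum/=.
  by rewrite (reindex_inj (@perm_inj _ p)); apply: eq_bigr => k _; rewrite nuE.
have -> : A *m A = invmx P *m (diag_mx sp *m diag_mx sp) *m P.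
  by rewrite {1}AE {1}AE !mulmxA -(mulmxA _ P) PVP mulmx1.
rewrite mxtrace_mulC !mulmxA PVP mul1mx mulmx_diag mxtrace_diag rmorph_sum/=.
rewrite (reindex_inj (@perm_inj _ p)); apply: eq_bigr => k _.
by rewrite mxE -nuE expr2 rmorphM.
Qed.

End Spectrum.

Section Eigenbasis.
Variables (R : realType) (n : nat).
Local Notation toC := (real_complex R).
Local Open Scope sesquilinear_scope.
Implicit Types (S Q : 'M[R[i]]_n) (p d : 'cV[R]_n) (v : 'cV[R[i]]_n).

Lemma map_secular (L : {poly R}) d q : map_poly toC (secular L d q) =
  map_poly toC L * \prod_j ('X - ((d j 0)%:C)%:P)
  - \sum_j (q j)%:C *: \prod_(i | i != j) ('X - ((d i 0)%:C)%:P).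
Proof.
rewrite rmorphB rmorphM rmorph_sum/= map_nodal; congr (_ - _).
apply: eq_bigr => j _; rewrite map_polyZ rmorph_prod; congr (_ *: _).
by apply: eq_bigr => k _; rewrite rmorphB/= map_polyX map_polyC.
Qed.

Lemma conj_toC (x : R) : (x%:C)^* = x%:C :> R[i].
Proof. exact: conjc_real. Qed.

Lemma conj_map_toC m k (A : 'M[R]_(m, k)) : (map_mx toC A)^t* = map_mx toC A^T.
Proof. by apply/matrixP => i j; rewrite !mxE; exact: conj_toC. Qed.

Lemma chart_adj Q p : (chart Q p)^t* = map_mx toC p^T *m Q^t*.
Proof. by rewrite /chart trmx_mul map_mxM conj_map_toC. Qed.

Lemma hermsymmxP S : S \is hermsymmx <-> S^t* = S.
Proof.
split=> [/is_hermitianmxP|SE]; first by rewrite expr0 scale1r => <-.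
by apply/is_hermitianmxP; rewrite expr0 scale1r SE.
Qed.

Lemma rank_one_hermitian S v : S \is hermsymmx -> S + tensor_sq v \is hermsymmx.
Proof.
move=> /hermsymmxP SE; apply/hermsymmxP; rewrite /tensor_sq.
by rewrite linearD map_mxD/= SE trmx_mul map_mxM trmxCK.
Qed.

Lemma cdotvv_trace v : cdot v v = \tr (v *m v^t*).
Proof. by rewrite mxtrace_mulC /cdot -trace_mx11. Qed.

End Eigenbasis.

Lemma bordered_hermitian (R : realType) n (S : 'M[R[i]]_n) v c :
  S \is hermsymmx -> bordered S v c \is hermsymmx.
Proof.
move=> /hermsymmxP SE; apply/hermsymmxP; rewrite /bordered.
rewrite tr_block_mx map_block_mx SE trmxCK tr_scalar_mx map_scalar_mx/=.
by congr (block_mx _ _ _ _%:M); exact: conj_toC.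
Qed.

Section DiagonalizedData.
Variables (R : realType) (n : nat) (S Q : 'M[R[i]]_n) (d : 'cV[R]_n).
Local Notation toC := (real_complex R).
Local Open Scope sesquilinear_scope.
Hypothesis QU : Q \is unitarymx.
Hypothesis SE : S = Q *m diag_mx (map_mx toC d^T) *m Q^t*.
Implicit Types p : 'cV[R]_n.

Let QQ : Q^t* *m Q = 1%:M.
Proof. by apply: mulmx1C; apply/unitarymxP. Qed.

Lemma char_poly_rank_one p : char_poly (S + tensor_sq (chart Q p)) =
  map_poly toC (secular 1 d (fun j => p j 0 ^+ 2)).
Proof.
have -> : S + tensor_sq (chart Q p) = Q *m (diag_mx (map_mx toC d^T)
    + map_mx toC p *m map_mx toC p^T) *m Q^t*.
  by rewrite SE /tensor_sq chart_adj /chart mulmxDr mulmxDl !mulmxA.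
rewrite char_poly_sim// char_poly_diagD_rank_one map_secular rmorph1 mul1r.
congr (_ - _); first by apply: eq_bigr => j _; rewrite !mxE.
apply: eq_bigr => j _; rewrite !mxE expr2 rmorphM; congr (_ *: _).
by apply: eq_bigr => i _; rewrite !mxE.
Qed.

Lemma char_poly_bordered p c : char_poly (bordered S (chart Q p) c) =
  map_poly toC (secular ('X - c%:P) d (fun j => p j 0 ^+ 2)).
Proof.
pose P : 'M[R[i]]_(n + 1) := block_mx Q 0 0 1%:M.
pose P' : 'M[R[i]]_(n + 1) := block_mx (Q^t*) 0 0 1%:M.
have PP : P' *m P = 1%:M.
  rewrite mulmx_block !mulmx0 !mul0mx !addr0 !add0r QQ mulmx1.
  by rewrite -scalar_mx_block.
have -> : bordered S (chart Q p) c = P *m (block_mx (diag_mx (map_mx toC d^T))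
    (map_mx toC p) (map_mx toC p^T) (toC c)%:M) *m P'.
  rewrite /bordered SE chart_adj /chart /P /P' !mulmx_block.
  by rewrite !mulmx0 !mul0mx !addr0 !add0r !mulmx1 !mul1mx.
rewrite char_poly_sim// char_poly_arrow map_secular.
congr (_ * _ - _).
- by rewrite rmorphB/= map_polyX map_polyC.
- by apply: eq_bigr => j _; rewrite !mxE.
apply: eq_bigr => j _; rewrite !mxE expr2 rmorphM; congr (_ *: _).
by apply: eq_bigr => i _; rewrite !mxE.
Qed.

Lemma cdot_chart p : cdot (chart Q p) (chart Q p) = (\sum_j p j 0 ^+ 2)%:C.
Proof.
rewrite /cdot chart_adj /chart mulmxA -(mulmxA _ _ Q) QQ mulmx1 mxE rmorph_sum.
by apply: eq_bigr => j _; rewrite !mxE expr2 rmorphM.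
Qed.

Lemma csphere_chart r p : 0 < r ->
  csphere r (chart Q p) <-> \sum_j p j 0 ^+ 2 = r ^+ 2.
Proof.
move=> r0; rewrite /csphere /= /cnorm cdot_chart; split=> [pr|->].
  by apply: complexI; rewrite -[LHS]sqrtCK pr rmorphXn.
by rewrite rmorphXn/= sqrCK// lecR ltW.
Qed.

Hypothesis Sh : S \is hermsymmx.
Let lam := sigma_o S.

Lemma sum_mapF p : \sum_k mapF S (chart Q p) k 0 =
  \sum_j p j 0 ^+ 2 + \sum_k lam k 0.
Proof.
have [_ _ trS _] := hermitian_spectrum Sh.
have [_ _ trA _] := hermitian_spectrum (rank_one_hermitian (chart Q p) Sh).
apply: complexI; rewrite -[LHS]trA linearD/= trS /tensor_sq -cdotvv_trace.
by rewrite cdot_chart rmorphD addrC.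
Qed.

Lemma sum_mapG p c : \sum_k mapG S (chart Q p, c) k 0 = \sum_k lam k 0 + c.
Proof.
have [_ _ trS _] := hermitian_spectrum Sh.
have [_ _ trA _] := hermitian_spectrum (bordered_hermitian (chart Q p) c Sh).
apply: complexI; rewrite -[LHS]trA /bordered mxtrace_block trS mxtrace_scalar.
by rewrite rmorphD mulr1n.
Qed.

Lemma sum_sqr_mapG p c : \sum_k mapG S (chart Q p, c) k 0 ^+ 2 =
  \sum_k lam k 0 ^+ 2 + 2 * \sum_j p j 0 ^+ 2 + c ^+ 2.
Proof.
have [_ _ _ trS] := hermitian_spectrum Sh.
have [_ _ _ trA] := hermitian_spectrum (bordered_hermitian (chart Q p) c Sh).
apply: complexI; rewrite -[LHS]trA /bordered mulmx_block mxtrace_block !linearD/=.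
rewrite trS -cdotvv_trace mxtrace_mulC -cdotvv_trace cdot_chart -scalar_mxM.
rewrite mxtrace_scalar mulr1n -rmorphM -!rmorphD /=; congr (_%:C).
by rewrite -/lam; ring.
Qed.

End DiagonalizedData.

Section Diagonalization.
Local Open Scope sesquilinear_scope.

(** Both the eigenvalues attached to the columns of Q and the entries of
    sigma_o S are the roots of the characteristic polynomial of S. *)
Lemma eigenbasis_diagonalization (R : realType) n (S Q : 'M[R[i]]_n)
    (lam := sigma_o S) :
  S \is hermsymmx -> orthonormal_eigenbasis S Q ->
  exists s : 'S_n, S = Q
    *m diag_mx (map_mx (real_complex R) (\col_j lam (s j) 0)^T) *m (Q^t*).
Proof.
move=> Sh [QU SQ]; have [_ chiS _ _] := hermitian_spectrum Sh.
have QQ : Q^t* *m Q = 1%:M by apply: mulmx1C; apply/unitarymxP.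
have [a aE] := choice SQ.
have SE : S = Q *m diag_mx (\row_j a j) *m (Q^t*).
  rewrite -[LHS]mulmx1 -(mulmx1C QQ) mulmxA; congr (_ *m _).
  apply/matrixP => i j; rewrite mul_mx_diag !mxE.
  have /colP/(_ i) := aE j; rewrite !mxE => aij.
  rewrite mulrC -aij; apply: eq_bigr => k _; by rewrite mxE.
have : perm_eq [seq a j | j <- enum 'I_n]
    [tuple (lam j 0)%:C | j < n].
  apply: prod_XsubC_eq; rewrite big_map big_enum big_tuple.
  under [RHS]eq_bigr do rewrite tnth_mktuple.
  rewrite -map_nodal -chiS SE char_poly_sim// char_poly_trig ?diag_mx_is_trig//.
  by apply: eq_bigr => j _; rewrite !mxE eqxx.
move=> /tuple_permP[s sE]; exists s.
rewrite {1}SE; congr (_ *m diag_mx _ *m _); apply/rowP => j; rewrite !mxE.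
have := congr1 (fun t => nth 0 t j) sE.
rewrite (nth_map j) ?size_enum_ord// nth_ord_enum => ->.
by rewrite -tnth_nth !tnth_mktuple [in LHS]mxE.
Qed.

End Diagonalization.

(** * Charts *)

Section ChartTopology.
Variable R : realType.
Local Open Scope sesquilinear_scope.

Lemma continuous_toC : continuous (real_complex R : R -> R[i]).
Proof.
move=> x V /nbhs_ballP[e /= e0 eV].
have eE : e = (complex.Re e)%:C by rewrite RRe_real// gtr0_real.
have r0 : 0 < complex.Re e by rewrite -ltcR -eE.
apply/nbhs_ballP; exists (complex.Re e) => //= y xy; apply: eV.
move: xy; rewrite /ball/= => xy.
by rewrite -rmorphB normc_def /= expr0n addr0 sqrtr_sqr eE ltcR.
Qed.

Lemma continuous_complex_Re : continuous (@complex.Re R : R[i] -> R).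
Proof.
move=> z V /nbhs_ballP[e /= e0 eV].
apply/nbhs_ballP; exists e%:C => /=; first by rewrite ltcR.
move=> y zy; apply: eV; move: zy; rewrite /ball/= => zy.
by rewrite -ltcR -raddfB (le_lt_trans (normc_ge_Re _)).
Qed.

Lemma continuous_linear_comb (X : topologicalType) n (a : 'I_n -> R[i])
    (F : 'I_n -> X -> R[i]) : (forall k, continuous (F k)) ->
  continuous (fun x => \sum_k a k * F k x).
Proof.
move=> cF; apply: continuous_big; first exact: (@add_continuous (R[i])^o).
move=> k _ x; apply: (@cvgM R[i]); [exact: cvg_cst|exact: cF].
Qed.

(** A continuous left inverse of the chart, defined on all of C^n by dropping
    the imaginary parts of the coordinates. *)
Definition unchart n (Q : 'M[R[i]]_n) (v : 'cV[R[i]]_n) : 'cV[R]_n :=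
  map_mx (@complex.Re R) (Q^t* *m v).

Lemma chartK n (Q : 'M[R[i]]_n) p : Q \is unitarymx -> unchart Q (chart Q p) = p.
Proof.
move=> /unitarymxP/mulmx1C QQ; rewrite /unchart /chart mulmxA QQ mul1mx.
by apply/colP => i; rewrite !mxE.
Qed.

Lemma continuous_chart n (Q : 'M[R[i]]_n) : continuous (chart Q).
Proof.
move=> p; apply: (@cvg_mx _ _ (nbhs_filter p)) => i j.
have -> : (fun x => chart Q x i j) = fun x => \sum_k Q i k * (x k j)%:C.
  by apply/funext => x; rewrite mxE; apply: eq_bigr => k _; rewrite mxE.
rewrite [chart Q p i j]mxE.
under [X in _ --> X]eq_bigr do rewrite mxE.
apply: (@continuous_linear_comb _ _ (fun k => Q i k)) => k q.
apply: (@cvg_comp _ _ _ (fun M : 'cV[R]_n => M k j) (real_complex R)).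
  exact: coord_continuous.
exact: continuous_toC.
Qed.

Lemma continuous_unchart n (Q : 'M[R[i]]_n) : continuous (unchart Q).
Proof.
move=> p; apply: (@cvg_mx _ _ (nbhs_filter p)) => i j.
have -> : (fun x => unchart Q x i j) =
    @complex.Re R \o (fun x => \sum_k (Q^t* ) i k * x k j).
  by apply/funext => x; rewrite /= !mxE.
rewrite [unchart Q p i j]mxE mxE.
apply: (@cvg_comp _ _ _ (fun v : 'cV[R[i]]_n => \sum_k (Q^t* ) i k * v k j)
  (@complex.Re R)); last first.
  exact: continuous_complex_Re.
apply: (@continuous_linear_comb _ _ (fun k => (Q^t* ) i k)
  (fun k (v : 'cV[R[i]]_n) => v k j)) => k q.
exact: continuous_mx_coord.
Qed.

End ChartTopology.

(** * The maps F and G *)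

Section Orthants.
Variables (R : realType) (n : nat).

Definition nonneg_coords : set 'cV[R]_n := [set p | forall j, 0 <= p j 0].
Definition pos_coords : set 'cV[R]_n := [set p | forall j, 0 < p j 0].

End Orthants.

Section Instances.
Variables (R : realType) (n : nat) (S Q : 'M[R[i]]_n) (t : 'S_n).
Local Notation toC := (real_complex R).
Local Open Scope sesquilinear_scope.
Variable lam : 'cV[R]_n.
Hypothesis lamE : sigma_o S = lam.
Let d : 'cV[R]_n := \col_j lam (t j) 0.
Hypothesis n_gt0 : (0 < n)%N.
Hypothesis Sh : S \is hermsymmx.
Hypothesis lam_incr : forall i j : 'I_n, (i < j)%N -> lam i 0 < lam j 0.
Hypothesis QU : Q \is unitarymx.
Hypothesis SE : S = Q *m diag_mx (map_mx toC d^T) *m Q^t*.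

Let d_inj : injective (fun j => d j 0).
Proof. exact: (permuted_nodes_inj (lam := lam) (t := t) erefl). Qed.

Let sum_d : \sum_j d j 0 = \sum_k lam k 0.
Proof.
rewrite [RHS](reindex_inj (@perm_inj _ t)).
by apply: eq_bigr => j _; rewrite mxE.
Qed.

Let toC_poly_inj : injective (map_poly toC).
Proof. exact: map_poly_inj. Qed.

Let weight_ge0_d m s (mu : 'cV[R]_m) j : m = (n + s)%N ->
  interlacing s lam mu -> 0 <= weight d mu j.
Proof.
move=> mE itl; rewrite (weight_perm (lam := lam) (t := t) erefl).
exact: (weight_ge0 mE lam_incr).
Qed.

Let sqr_inverse_coords m s (mu : 'cV[R]_m) L : m = (n + s)%N ->
  interlacing s lam mu ->
  secular L d (fun j => inverse_coords d mu j 0 ^+ 2) = secular L d (weight d mu).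
Proof.
move=> mE itl; rewrite /secular; congr (_ - _); apply: eq_bigr => j _.
by rewrite mxE sqr_sqrtr// (weight_ge0_d j mE itl).
Qed.

Let nodal_mapF p : nodal (mapF S (chart Q p)) =
  secular 1 d (fun j => p j 0 ^+ 2).
Proof.
apply: toC_poly_inj; rewrite -(char_poly_rank_one QU SE).
by have [_ <-] := hermitian_spectrum (rank_one_hermitian (chart Q p) Sh).
Qed.

Let nodal_mapG p c : nodal (mapG S (chart Q p, c)) =
  secular ('X - c%:P) d (fun j => p j 0 ^+ 2).
Proof.
apply: toC_poly_inj; rewrite -(char_poly_bordered QU SE).
by have [_ <-] := hermitian_spectrum (bordered_hermitian (chart Q p) c Sh).
Qed.

Let inverse_coordsK m (mu : 'cV[R]_m) L (p : 'cV[R]_n) :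
  nodal mu = secular L d (fun j => p j 0 ^+ 2) -> (forall j, 0 <= p j 0) ->
  inverse_coords d mu = p.
Proof.
move=> muE p0; apply/colP => j; rewrite mxE (secular_weight d_inj j muE).
by rewrite sqrtr_sqr ger0_norm.
Qed.

Lemma mapF_homeo_diffeo :
  homeomorphism_on (@nonneg_coords R n) (polyF lam) (mapF S \o chart Q) /\
  diffeomorphism_on (@pos_coords R n) (interior (polyF lam)) (mapF S \o chart Q).
Proof.
have nE : n = (n + 0)%N by rewrite addn0.
rewrite polyF_interlacing//.
pose b (p : 'cV[R]_n) := \sum_k `|lam k 0| + \sum_j p j 0 ^+ 2.
have crd_cont j : continuous (fun e : 'cV[R]_n => id e j 0) by exact: coord_continuous.
have crd_shift (e : 'cV[R]_n) x j : id (e + x *: const_mx 1) j 0 = id e j 0 + x.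
  by rewrite !mxE mulr1.
have f_sort e (k l : 'I_n) : (k <= l)%N ->
    (mapF S \o chart Q) e k 0 <= (mapF S \o chart Q) e l 0.
  have [+ _ _ _] := hermitian_spectrum (rank_one_hermitian (chart Q e) Sh).
  by apply.
have f_smooth l k : Ck k setT (fun e => (nodal ((mapF S \o chart Q) e))`_l).
  apply: (@Ck_eq _ _ _ openT _ _
    (fun e : 'cV[R]_n => (secular 1 d (fun j => e j 0 ^+ 2))`_l)).
    by move=> e _; rewrite -nodal_mapF.
  apply: (Ck_secular_coef (L := fun=> 1) (q := fun (e : 'cV[R]_n) j => e j 0 ^+ 2)).
    exact: (Ck_cst openT).
  by move=> j; apply: CkX; [exact: openT|exact: Ck_coord openT].
have g_crd (mu : 'cV[R]_n) j : id (inverse_coords d mu) j 0 = Num.sqrt (weight d mu j).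
  by rewrite mxE.
have fK (e : 'cV[R]_n) : (forall j, 0 <= id e j 0) ->
    inverse_coords d ((mapF S \o chart Q) e) = e.
  by apply: inverse_coordsK; exact: nodal_mapF.
have gK mu : interlacing 0 lam mu -> (mapF S \o chart Q) (inverse_coords d mu) = mu.
  move=> itl; apply: sigma_o_eq; last exact: (interlacing_sorted nE _ itl).
  rewrite (char_poly_rank_one QU SE) (sqr_inverse_coords _ nE itl).
  by congr map_poly; rewrite -secular_of_weight//; exact: size_nodalB.
have b_cont : continuous b.
  suff : Ck 0 setT b by move=> cb x; exact: cb.
  apply: CkD; [exact: openT|exact: (Ck_cst openT)|].
  by apply: (Ck_sum openT) => j _; apply: CkX; [exact: openT|exact: Ck_coord openT].
have f_bound e : interlacing 0 lam ((mapF S \o chart Q) e) ->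
    forall k, `|(mapF S \o chart Q) e k 0| <= b e.
  (* every mu_l is at least lam_l, so none exceeds it by more than |p|^2 *)
  set mu := _ e => itl k.
  have D l : 0 <= mu l 0 - lam l 0.
    by rewrite subr_ge0; have [_] := itl l l; apply; rewrite addn0.
  have Dk : mu k 0 - lam k 0 <= \sum_j e j 0 ^+ 2.
    have <- : \sum_l (mu l 0 - lam l 0) = \sum_j e j 0 ^+ 2.
      by rewrite sumrB (sum_mapF QU Sh) lamE addrK.
    by rewrite (bigD1 k)//= lerDl sumr_ge0.
  have Lk : `|lam k 0| <= \sum_l `|lam l 0| by rewrite (bigD1 k)//= lerDl sumr_ge0.
  rewrite -(subrK (lam k 0) (mu k 0)) addrC (le_trans (ler_normD _ _))//.
  by rewrite lerD// ger0_norm.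
have g_cont := @continuous_inverse_coords R n n d.
have g_smooth k U := @Ck_inverse_coords R n n d U k.
exact: (@spectral_map_homeo_diffeo R 'cV[R]_n n n 0 lam d t nE isT lam_incr erefl
  id (const_mx 1) (mapF S \o chart Q) (inverse_coords d) (fun=> 1) b
  crd_cont crd_shift f_sort nodal_mapF f_smooth g_crd g_cont g_smooth
  fK gK b_cont f_bound).
Qed.

Lemma mapG_homeo_diffeo :
  homeomorphism_on (@nonneg_coords R n `*` [set: R]) (polyG lam) (mapG S \o chart1 Q) /\
  diffeomorphism_on (@pos_coords R n `*` [set: R]) (interior (polyG lam))
    (mapG S \o chart1 Q).
Proof.
rewrite polyG_interlacing//.
have oT : open [set: 'cV[R]_n * R] := openT.
pose f := mapG S \o chart1 Q.
pose q (e : 'cV[R]_n * R) :=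
  \sum_k lam k 0 ^+ 2 + 2 * \sum_j e.1 j 0 ^+ 2 + e.2 ^+ 2.
pose g (mu : 'cV[R]_(n + 1)) : 'cV[R]_n * R :=
  (inverse_coords d mu, \sum_k mu k 0 - \sum_k lam k 0).
have C1 k j : Ck k setT (fun e : 'cV[R]_n * R => e.1 j 0).
  apply: (Ck_linear_map (F := fun e : 'cV[R]_n * R => e.1 j 0) k oT).
    by move=> a x y; rewrite !mxE.
  move=> x; apply: (@cvg_comp _ _ _ fst (fun v : 'cV[R]_n => v j 0)).
    exact: cvg_fst.
  exact: coord_continuous.
have C2 k : Ck k setT (fun e : 'cV[R]_n * R => e.2).
  apply: (Ck_linear_map (F := fun e : 'cV[R]_n * R => e.2) k oT).
    by move=> a x y.
  by move=> x; exact: cvg_snd.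
have Cq k : Ck k setT q.
  apply: (CkD oT); last exact: CkX.
  apply: (CkD oT); first exact: (Ck_cst oT).
  apply: (CkM oT); first exact: (Ck_cst oT).
  by apply: (Ck_sum oT) => j _; apply: (CkX oT).
have crd_cont j : continuous (fun e : 'cV[R]_n * R => e.1 j 0).
  by move=> e; exact: (C1 0).
have crd_shift (e : 'cV[R]_n * R) x j :
    (e + x *: ((const_mx 1, 0) : 'cV[R]_n * R)).1 j 0 = e.1 j 0 + x.
  by rewrite !mxE mulr1.
have f_sort e (k l : 'I_(n + 1)) : (k <= l)%N -> f e k 0 <= f e l 0.
  have [+ _ _ _] := hermitian_spectrum (bordered_hermitian (chart Q e.1) e.2 Sh).
  by apply.
have f_char e : nodal (f e) = secular ('X - (e.2)%:P) d (fun j => e.1 j 0 ^+ 2).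
  exact: nodal_mapG.
have f_smooth l k : Ck k setT (fun e => (nodal (f e))`_l).
  apply: (@Ck_eq _ _ _ oT _ _ (fun e : 'cV[R]_n * R =>
      (secular ('X - (e.2)%:P) d (fun j => e.1 j 0 ^+ 2))`_l)).
    by move=> e _; rewrite f_char.
  apply: (Ck_secular_coef (L := fun e : 'cV[R]_n * R => 'X - (e.2)%:P)
    (q := fun (e : 'cV[R]_n * R) j => e.1 j 0 ^+ 2)); last by move=> j; exact: CkX.
  apply: (@Ck_eq _ _ _ oT _ _ (fun e : 'cV[R]_n * R =>
      ('X * nodal d)`_l - e.2 * (nodal d)`_l)).
    by move=> e _; rewrite mulrBl coefB coefCM.
  apply: (CkB oT); first exact: (Ck_cst oT).
  by apply: (CkM oT) => //; exact: (Ck_cst oT).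
have g_crd mu j : (g mu).1 j 0 = Num.sqrt (weight d mu j) by rewrite mxE.
have fK (e : 'cV[R]_n * R) : (forall j, 0 <= e.1 j 0) -> g (f e) = e.
  case: e => p c /= p0; rewrite /g (inverse_coordsK (f_char (p, c)))//.
  by rewrite (sum_mapG Q Sh p c) lamE addrAC subrr add0r.
have gK mu : interlacing 1 lam mu -> f (g mu) = mu.
  move=> itl; apply: sigma_o_eq; last exact: (interlacing_sorted erefl _ itl).
  rewrite (char_poly_bordered QU SE) (sqr_inverse_coords _ erefl itl).
  congr map_poly; rewrite -secular_of_weight//; apply: size_nodal1B => //=.
  by rewrite sum_d addrC subrK.
have b_cont : continuous (fun e => 1 + q e).
  suff : Ck 0 setT (fun e => 1 + q e) by move=> cq e; exact: cq.
  by apply: (CkD oT); first exact: (Ck_cst oT).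
have f_bound e : interlacing 1 lam (f e) -> forall k, `|f e k 0| <= 1 + q e.
  move=> _ k; have <- : \sum_l f e l 0 ^+ 2 = q e.
    by rewrite (sum_sqr_mapG QU Sh e.1 e.2) lamE.
  have fk : f e k 0 ^+ 2 <= \sum_l f e l 0 ^+ 2.
    by rewrite (bigD1 k)//= lerDl sumr_ge0// => l _; exact: sqr_ge0.
  (* |x| <= 1 + x^2 *)
  rewrite ler_norml; nra.
have G2 (U : set 'cV[R]_(n + 1)) k : open U ->
    Ck k U (fun mu => \sum_k mu k 0 - \sum_k lam k 0).
  move=> oU; apply: (CkB oU); last exact: (Ck_cst oU).
  by apply: (Ck_sum oU) => i _; exact: Ck_coord.
have g_cont : continuous g.
  apply: continuous_pair; first exact: continuous_inverse_coords.
  by move=> mu; exact: (G2 setT 0 openT).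
have g_smooth k (U : set 'cV[R]_(n + 1)) : open U ->
    (forall mu j, U mu -> 0 < weight d mu j) -> Ck k U g.
  move=> oU w0; apply: (Ck_pair oU); last exact: G2.
  exact: Ck_inverse_coords.
have D (B : set 'cV[R]_n) : B `*` [set: R] = [set e | B e.1].
  by apply/seteqP; split=> [e []|e Be] //; split.
rewrite !D.
exact: (@spectral_map_homeo_diffeo R _ n (n + 1) 1 lam d t erefl isT lam_incr erefl
  fst (const_mx 1, 0) f g (fun e => 'X - (e.2)%:P) (fun e => 1 + q e)
  crd_cont crd_shift f_sort f_char f_smooth g_crd g_cont g_smooth
  fK gK b_cont f_bound).
Qed.

End Instances.

Section Transport.
Variables (R : realType) (n : nat) (Q : 'M[R[i]]_n) (lam : 'cV[R]_n).
Hypothesis QU : Q \is unitarymx.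

Let chart_inj : injective (chart Q).
Proof. by apply: (can_inj (g := unchart Q)) => p; exact: chartK. Qed.

(** The sets C and D carry the additional equations of a restricted map, on the
    side of the coordinates and on the side of the spectra. *)
Lemma homeo_diffeoF_restrict (f : 'cV[R[i]]_n -> 'cV[R]_n) C D A B :
  homeomorphism_on (@nonneg_coords R n) (polyF lam) (f \o chart Q) /\
  diffeomorphism_on (@pos_coords R n) (interior (polyF lam)) (f \o chart Q) ->
  (forall p, nonneg_coords p -> C p <-> D (f (chart Q p))) ->
  A = chart Q @` (@nonneg_coords R n `&` C) -> B = polyF lam `&` D ->
  homeo_diffeoF Q lam A B f.
Proof.
move=> [homeo diffeo] CD -> ->; split.
  apply: (homeomorphism_on_image (h' := unchart Q)).
  - exact: continuous_chart.
  - exact: continuous_unchart.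
  - by move=> p; exact: chartK.
  exact: homeomorphism_on_restrict.
have -> : chart Q @^-1` ((chart Q @` (@nonneg_coords R n `&` C))
    `&` orthant_interior Q) = @pos_coords R n `&` C.
  apply/seteqP; split=> [p|p [p0 Cp]].
    move=> [[p1 [_ Cp] /chart_inj pE] [p2 p20 /chart_inj p2E]].
    by rewrite -p2E; split=> //; rewrite p2E -pE.
  split; last by exists p.
  by exists p => //; split=> // j; exact/ltW/p0.
have -> : polyF lam `&` D `&` interior (polyF lam) = interior (polyF lam) `&` D.
  rewrite -setIA [D `&` _]setIC setIA; congr (_ `&` _).
  by apply/setIidPr; exact: interior_subset.
apply: diffeomorphism_on_restrict => // p p0; apply: CD => j; exact/ltW/p0.
Qed.

Lemma homeo_diffeoG_restrict (f : 'cV[R[i]]_n * R -> 'cV[R]_(n + 1)) C D A B :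
  homeomorphism_on (@nonneg_coords R n `*` [set: R]) (polyG lam) (f \o chart1 Q) /\
  diffeomorphism_on (@pos_coords R n `*` [set: R]) (interior (polyG lam))
    (f \o chart1 Q) ->
  (forall e, nonneg_coords e.1 -> C e <-> D (f (chart1 Q e))) ->
  A = chart1 Q @` ((@nonneg_coords R n `*` [set: R]) `&` C) ->
  B = polyG lam `&` D ->
  homeo_diffeoG Q lam A B f.
Proof.
move=> [homeo diffeo] CD -> ->.
have chart1_inj : injective (chart1 Q).
  by move=> [p x] [p' x'] [/chart_inj -> ->].
split.
  apply: (homeomorphism_on_image (h' := fun vc => (unchart Q vc.1, vc.2))).
  - apply: continuous_pair; last by move=> x; exact: cvg_snd.
    by move=> x; apply: (@cvg_comp _ _ _ fst (chart Q));
      [exact: cvg_fst|exact: continuous_chart].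
  - apply: continuous_pair; last by move=> x; exact: cvg_snd.
    by move=> x; apply: (@cvg_comp _ _ _ fst (unchart Q));
      [exact: cvg_fst|exact: continuous_unchart].
  - by move=> [p x]; rewrite /chart1 /= chartK.
  by apply: homeomorphism_on_restrict => // e [e0 _]; exact: CD.
have -> : chart1 Q @^-1` ((chart1 Q @` ((@nonneg_coords R n `*` [set: R]) `&` C))
    `&` (orthant_interior Q `*` setT)) = (@pos_coords R n `*` [set: R]) `&` C.
  apply/seteqP; split=> [e|e [[e0 _] Ce]].
    move=> [[e1 [_ Ce] /chart1_inj eE] [[p p0 /chart_inj pE] _]].
    by split; [split=> //; rewrite -pE|rewrite -eE].
  split; last by split=> //; exists e.1.
  by exists e => //; split=> //; split=> // j; exact/ltW/e0.
have -> : polyG lam `&` D `&` interior (polyG lam) = interior (polyG lam) `&` D.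
  rewrite -setIA [D `&` _]setIC setIA; congr (_ `&` _).
  by apply/setIidPr; exact: interior_subset.
by apply: diffeomorphism_on_restrict => // e [e0 _]; apply: CD => j; exact/ltW/e0.
Qed.

End Transport.

Theorem theorem1p3 (R : realType) (n : nat) (hn : (0 < n)%N)
    (S : 'M[R[i]]_n) (hS : S \is hermsymmx)
    (lam : 'cV[R]_n) (hlam : sigma_o S = lam)
    (hsimple : forall j k : 'I_n, (j < k)%N -> lam j 0 < lam k 0)
    (Q : 'M[R[i]]_n) (hQ : orthonormal_eigenbasis S Q)
    (r : R) (hr : 0 < r) (c : R) :
  [/\ homeo_diffeoF Q lam (orthant Q) (polyF lam) (mapF S),
      homeo_diffeoG Q lam (orthant Q `*` setT) (polyG lam) (mapG S),
      homeo_diffeoF Q lam (orthant Q `&` csphere r) (polyFr lam r) (mapF S),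
      homeo_diffeoG Q lam (orthant Q `*` [set c]) (polyGc lam c) (mapG S)
    & homeo_diffeoG Q lam ((orthant Q `&` csphere r) `*` [set c])
        (polyGrc lam r c) (mapG S)].
Proof.
have [QU _] := hQ; have [t SE] := eigenbasis_diagonalization hS hQ.
rewrite hlam in SE.
have coreF := mapF_homeo_diffeo hlam hS hsimple QU SE.
have coreG := mapG_homeo_diffeo hlam hn hS hsimple QU SE.
have sumG e : \sum_k mapG S (chart1 Q e) k 0 = \sum_k lam k 0 + e.2.
  by rewrite (sum_mapG Q hS) hlam.
have sum2G e : \sum_k mapG S (chart1 Q e) k 0 ^+ 2 =
    \sum_k lam k 0 ^+ 2 + 2 * \sum_j e.1 j 0 ^+ 2 + e.2 ^+ 2.
  by rewrite (sum_sqr_mapG QU hS) hlam.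
split.
- apply: (homeo_diffeoF_restrict QU (C := setT) (D := setT) coreF) => //.
  + by rewrite setIT.
  + by rewrite setIT.
- apply: (homeo_diffeoG_restrict QU (C := setT) (D := setT) coreG) => //.
  + rewrite setIT; apply/seteqP; split=> [[v x] [[p p0 /= <-] _]|_ [[p x] [p0 _] <-]].
      by exists (p, x).
    by split=> //; exists p.
  + by rewrite setIT.
- apply: (homeo_diffeoF_restrict QU
    (C := [set p : 'cV[R]_n | \sum_j p j 0 ^+ 2 = r ^+ 2]) coreF _ _ erefl).
  + move=> p _ /=; rewrite (sum_mapF QU hS) hlam.
    by split=> [->//|/addIr].
  + apply/seteqP; split=> [_ [[p p0 <-] /(csphere_chart QU _ hr) pr]|_ [p [p0 pr] <-]].
      by exists p.
    by split; [exists p|apply/(csphere_chart QU _ hr)].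
- apply: (homeo_diffeoG_restrict QU (C := [set e | e.2 = c]) coreG _ _ erefl).
  + by move=> e _ /=; rewrite sumG; split=> [->//|/addrI].
  + apply/seteqP; split=> [[v x] [[p p0 /= <-] ->]|_ [[p x] [[p0 _] /= ->] <-]].
      by exists (p, c).
    by split=> //; exists p.
- apply: (homeo_diffeoG_restrict QU
    (C := [set e : 'cV[R]_n * R | e.2 = c /\ \sum_j e.1 j 0 ^+ 2 = r ^+ 2])
    (D := [set mu : 'cV[R]_(n + 1) | \sum_j mu j 0 = \sum_k lam k 0 + c] `&`
          [set mu : 'cV[R]_(n + 1) | \sum_j mu j 0 ^+ 2 =
                    \sum_k lam k 0 ^+ 2 + 2 * r ^+ 2 + c ^+ 2])
    coreG).
  + move=> e _ /=; rewrite sumG sum2G; split=> [[-> ->]//|[/addrI -> er]].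
    by split=> //; move: er; lra.
  + apply/seteqP; split=> [[v x] [/= [[p p0 <-] /(csphere_chart QU _ hr) pr] ->]|].
      by exists (p, c).
    move=> _ [[p x] [[p0 _] /= [-> pr]] <-].
    by split=> //; split; [exists p|apply/(csphere_chart QU _ hr)].
  + by rewrite setIA.
Qed.
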